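(* Let $k\ge1$ be an integer, let $\lambda_1,\dots,\lambda_k>0$, put $\Lambda=\sum_{j=1}^k\lambda_j$, and let $a,b>0$. Let $\{Z(t)\}_{t\ge0}$ be the gamma subordinator with parameters $a,b$, let $\{M(t)\}_{t\ge0}$ be a generalized counting process with rates $\lambda_1,\dots,\lambda_k$ independent of $Z$, and let $\mathcal Z_{f_1}(t)=M(Z(t))$. Then the Lévy measure of $\mathcal Z_{f_1}$ is $$\Pi_{f_1}(\mathrm dx)=\sum_{n=1}^\infty\sum_{\Omega(k,n)}\prod_{j=1}^k\frac{\lambda_j^{x_j}}{x_j!}\,\frac{b\,\Gamma(s_k)}{(\Lambda+a)^{s_k}}\,\delta_n(\mathrm dx),$$ where $\Omega(k,n)=\{(x_1,\dots,x_k)\in\mathbb N_0^k:x_1+2x_2+\dots+kx_k=n\}$, $s_k=x_1+x_2+\dots+x_k$, and $\delta_n$ is the Dirac measure at $n$.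
   Context: The generalized counting process (GCP) with positive rates $\lambda_1,\dots,\lambda_k$ is the counting process $\{M(t)\}_{t\ge0}$ with $M(0)=0$ that performs $k$ kinds of jumps of amplitude $1,2,\dots,k$ with rates $\lambda_1,\dots,\lambda_k$, respectively; equivalently it is (in law) the Lévy process $M(t)=\sum_{j=1}^k jN_j(t)$, where $N_1,\dots,N_k$ are independent Poisson processes with intensities $\lambda_1,\dots,\lambda_k$. The gamma subordinator with parameters $a,b>0$ is the subordinator $\{Z(t)\}_{t\ge0}$ such that $Z(t)$ has density $g(x,t)=\frac{a^{bt}}{\Gamma(bt)}x^{bt-1}e^{-ax}$, $x>0$; its Bernstein function is $f_1(s)=b\log(1+s/a)$, i.e. $\mathbb E(e^{-sZ(t)})=e^{-tf_1(s)}$, $s>0$. *)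

(* Defs.v *)
From HB Require Import structures.
From mathcomp Require Import all_boot all_order all_algebra.
From mathcomp Require Import all_classical all_reals all_analysis.
From mathcomp Require Import complex.

Set Implicit Arguments.
Unset Strict Implicit.
Unset Printing Implicit Defensive.

Import Order.TTheory GRing.Theory Num.Theory.
Import numFieldNormedType.Exports.

Local Open Scope classical_set_scope.
Local Open Scope ring_scope.
Local Open Scope complex_scope.

(* Processes are functions R -> T -> S of which only the times t >= 0 matter.
   Path properties (value at time 0, monotonicity, regularity) are required for
   every sample point, so that the composition M (Z t w) w is well defined and
   measurable without completing the probability space. *)

Section Processes.
Context {R : realType} {d : measure_display} {T : measurableType d}.
Variable P : probability T R.

Definition cadlag (f : R -> R) : Prop :=
  (forall t, 0 <= t -> f s @[s --> t^'+] --> f t) /\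
  (forall t, 0 < t -> cvg (f s @[s --> t^'-])).

Definition independent_increments (X : R -> T -> R) : Prop :=
  forall (n : nat) (t : nat -> R) (A : nat -> set R),
    0 <= t 0%N -> (forall i, t i <= t i.+1) -> (forall i, measurable (A i)) ->
    P (\bigcap_(i < n) [set w | A i (X (t i.+1) w - X (t i) w)]) =
    (\prod_(i < n) P [set w | A i (X (t i.+1) w - X (t i) w)%R])%E.

Definition stationary_increments (X : R -> T -> R) : Prop :=
  forall (s t : R) (A : set R), 0 <= s -> s <= t -> measurable A ->
    P [set w | A (X t w - X s w)] = P [set w | A (X (t - s) w)].

Definition levy_process (X : R -> T -> R) : Prop :=
  [/\ forall t, 0 <= t -> measurable_fun setT (X t),
      forall w, X 0 w = 0,
      independent_increments X,
      stationary_increments X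
    & forall w, cadlag (X ^~ w)].

Definition subordinator (Z : R -> T -> R) : Prop :=
  levy_process Z /\
  forall w s t, 0 <= s -> s <= t -> Z s w <= Z t w.

Definition counting_process (N : R -> T -> nat) : Prop :=
  [/\ forall t, 0 <= t -> measurable_fun setT (N t),
      forall w, N 0 w = 0%N,
      forall w s t, 0 <= s -> s <= t -> (N s w <= N t w)%N
    & forall w, cadlag (fun t => (N t w)%:R)].

(* The law is prescribed for t > 0 only because poisson_pmf 0 is constantly 1;
   N 0 = 0 is part of counting_process. *)
Definition poisson_process (l : R) (N : R -> T -> nat) : Prop :=
  [/\ counting_process N,
      levy_process (fun t w => (N t w)%:R)
    & forall t n, 0 < t ->
        P [set w | N t w = n] = (poisson_pmf (l * t) n)%:E].

Definition process_sigma_algebra d' (S : measurableType d') (X : R -> T -> S) :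
    set (set T) :=
  <<s [set B | exists t A, [/\ 0 <= t, measurable A & B = X t @^-1` A]] >>.

Definition independent_processes d1 d2 (S1 : measurableType d1)
    (S2 : measurableType d2) (X : R -> T -> S1) (Y : R -> T -> S2) : Prop :=
  forall A B, process_sigma_algebra X A -> process_sigma_algebra Y B ->
    P (A `&` B) = (P A * P B)%E.

(* The full product rule suffices for a finite family: each sigma-algebra
   contains setT, so it covers all subfamilies. *)
Definition mutually_independent_processes (I : finType) d'
    (S : measurableType d') (X : I -> R -> T -> S) : Prop :=
  forall A : I -> set T, (forall i, process_sigma_algebra (X i) (A i)) ->
    P (\bigcap_i A i) = (\prod_i P (A i))%E.

End Processes.

(* The index j : 'I_k stands for the amplitude j.+1, so l j is the rate
   lambda_(j+1). A GCP is a counting process with the same finite-dimensional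
   distributions as sum_j (j+1) N_j, where the independent Poisson processes N_j
   may live on another probability space. *)
Definition generalized_counting_process (R : realType) (d : measure_display)
    (T : measurableType d) (P : probability T R) (k : nat) (l : 'I_k -> R)
    (M : R -> T -> nat) : Prop :=
  counting_process M /\
  exists (d' : measure_display) (T' : measurableType d')
      (P' : probability T' R) (N : 'I_k -> R -> T' -> nat),
    [/\ forall j, poisson_process P' (l j) (N j),
        mutually_independent_processes P' N
      & forall (n : nat) (t : 'I_n -> R) (m : 'I_n -> nat),
          (forall i, 0 <= t i) ->
          P [set w | forall i, M (t i) w = m i] =
          P' [set w | forall i, (\sum_(j < k) j.+1 * N j (t i) w)%N = m i]].

Section Gamma.
Context {R : realType}.

Definition Gamma (x : R) : R :=
  \int[lebesgue_measure]_(u in `]0, +oo[) (u `^ (x - 1) * expR (- u)).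

Definition gamma_density (a b t x : R) : R :=
  if 0 < x then
    a `^ (b * t) / Gamma (b * t) * x `^ (b * t - 1) * expR (- (a * x))
  else 0.

Definition gamma_subordinator d (T : measurableType d) (P : probability T R)
    (a b : R) (Z : R -> T -> R) : Prop :=
  subordinator P Z /\
  forall (t : R) (A : set R), 0 < t -> measurable A ->
    P [set w | A (Z t w)] =
    (\int[lebesgue_measure]_(x in A) (gamma_density a b t x)%:E)%E.

End Gamma.

Section LevyMeasure.
Context {R : realType}.

Definition cexp (z : R[i]) : R[i] :=
  (expR (complex.Re z) * cos (complex.Im z)) +i* (expR (complex.Re z) * sin (complex.Im z)).

Definition cintegral d (T : measurableType d)
    (mu : {measure set T -> \bar R}) (f : T -> R[i]) : R[i] :=
  (\int[mu]_x complex.Re (f x)) +i* (\int[mu]_x complex.Im (f x)).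

Definition characteristic_function d (T : measurableType d)
    (P : probability T R) (X : T -> R) (u : R) : R[i] :=
  cintegral P (fun w => cexp (0 +i* (u * X w))).

(* Levy-Khintchine exponent of the triplet (c, s2, nu), with the truncation
   function x * 1_(|x| <= 1). *)
Definition levy_khintchine_exponent (c s2 : R)
    (nu : {measure set R -> \bar R}) (u : R) : R[i] :=
  (- (s2 * u ^+ 2 / 2)) +i* (c * u) +
  cintegral nu (fun x => cexp (0 +i* (u * x)) - 1
                         - 0 +i* (if `|x| <= 1 then u * x else 0)).

(* nu is the Levy measure of the Levy process X, i.e. the jump measure of its
   Levy-Khintchine triplet; such a nu is unique. *)
Definition is_levy_measure d (T : measurableType d) (P : probability T R)
    (X : R -> T -> R) (nu : {measure set R -> \bar R}) : Prop :=
  [/\ forall t, 0 <= t -> measurable_fun setT (X t),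
      nu [set 0] = 0%E,
      (\int[nu]_x (Num.min 1 (x ^+ 2))%:E < +oo)%E
    & exists c s2 : R, 0 <= s2 /\
        forall t u, 0 <= t ->
          characteristic_function P (X t) u =
          cexp (t%:C * levy_khintchine_exponent c s2 nu u)].

End LevyMeasure.

(* Omega(k,n); a solution of x_1 + 2 x_2 + ... + k x_k = n has every x_j <= n,
   so the bound in 'I_n.+1 excludes nothing. *)
Definition Omega (k n : nat) : {set {ffun 'I_k -> 'I_n.+1}} :=
  [set x : {ffun 'I_k -> 'I_n.+1} | (\sum_(j < k) j.+1 * x j)%N == n]%SET.

(* Main.v *)
Require Import Defs.
From HB Require Import structures.
From mathcomp Require Import all_boot all_order all_algebra.
From mathcomp Require Import all_classical all_reals all_analysis.
From mathcomp Require Import complex.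
From mathcomp Require Import measurable_realfun ring lra.

Set Implicit Arguments.
Unset Strict Implicit.
Unset Printing Implicit Defensive.

Import Order.TTheory GRing.Theory Num.Theory.
Import numFieldNormedType.Exports.

Local Open Scope classical_set_scope.
Local Open Scope ring_scope.

(** Let L(z) = sum_j lambda_j z^j, Lambda = L(1), D = Lambda + a, rho = Lambda / D
    and w(u) = L(e^(iu)) / D, so that |w(u)| <= rho < 1.

    The proof compares two measures carried by the natural numbers, both with
    masses of the form
        p_n = sum_s beta_s [z^n] (L(z) / D)^s                 ([lattice_mass]).
    Grouping the solutions of x_1 + 2 x_2 + ... + k x_k = n by their sum s and
    using the multinomial theorem ([sum_Omega]), the measure Pi of the statement
    has this form with beta_s = b / s.  The law of M(Z(t)) has it too: given
    Z(t) = x, the counting process is at n with probability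
    e^(-Lambda x) sum_s [z^n] L(z)^s x^s / s! ([gcp_law]), and integrating
    x^s e^(-Lambda x) against the gamma density gives a constant C_t times the
    rising factorial of bt over D^s, because x Gamma(x) = Gamma(x + 1).  Hence
    beta_s = C_t (bt)(bt + 1)...(bt + s - 1) / s! ([subordinated_pmf]).

    For any measure of this form the integral of e^(iux) is
    sum_s beta_s w(u)^s ([lattice_cos], [lattice_sin]).  With l(w) the series
    sum_(s >= 1) w^s / s, the binomial series
        sum_s r(r + 1)...(r + s - 1) / s! w^s = exp (r l(w))
    ([binomial_series]) turns the characteristic function of M(Z(t)) into
    C_t exp (bt l(w(u))).  At u = 0 this must be 1, so C_t = exp (- bt l(rho)),
    and the characteristic function is
        exp (t b (l(w(u)) - l(rho))) = exp (t * integral of (e^(iux) - 1) dPi).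
    This is the Levy-Khintchine formula without Gaussian part, the drift being
    the integral of the truncation function, which exists as Pi is finite.

    No complex logarithm or complex gamma integral enters: real and imaginary
    parts of powers of w are treated as real sequences, and the binomial series
    is obtained from a differential equation in a real parameter.  The only
    probabilistic limit argument is the passage from M(x) to M(Z(t)): Z(t) is
    rounded up to a grid, where independence can be used atom by atom, and right
    continuity of the paths removes the grid ([random_time_pmf]). *)

(** * The multinomial theorem on Omega *)

(** The multinomial theorem read off from exp(y_1 T) ... exp(y_m T) = exp((sum y) T):
    truncating the exponential series at degree N does not affect the coefficients
    up to N.  The inverse factorials are passed as a sequence c so that the ring may
    be a polynomial ring. *)
Lemma coef_prod_expsum (K : comNzRingType) (c : nat -> K) (I : finType)
    (y : I -> K) (N s : nat) :
  (forall n, n`!%:R * c n = 1) -> (s <= N)%N ->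
  (\prod_(j : I) \poly_(i < N.+1) (c i * y j ^+ i))`_s =
  c s * (\sum_j y j) ^+ s.
Proof.
move=> cV.
have cE n m : (m <= n)%N -> c n * 'C(n, m)%:R = c m * c (n - m)%N.
  move=> mn; have := bin_fact mn => /(congr1 (fun x => x%:R : K)).
  rewrite !natrM => E.
  have -> : c n * 'C(n, m)%:R =
     c n * ('C(n, m)%:R * ((m`!)%:R * (n - m)`!%:R)) * (c m * c (n - m)%N).
    transitivity (c n * 'C(n, m)%:R * ((m`!%:R * c m) * ((n - m)`!%:R * c (n - m)%N))).
      by rewrite !cV !mulr1.
    ring.
  by rewrite E [c n * _]mulrC cV mul1r.
elim/big_rec2 : _ s => [s _|j y1 y2 _ IH s sN].
  rewrite coef1 expr0n; case: s => [|s]; rewrite ?mulr0 ?mulr1//=.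
  by rewrite -[c 0%N]mul1r (cV 0%N).
rewrite coefM exprDn mulr_sumr -(big_mkord xpredT (fun i => (\poly_(i < N.+1) (c i * y j ^+ i))`_i * y2`_(s - i)%N)).
rewrite big_nat_rev /= add0n big_mkord; apply: eq_bigr => i _.
have is_ : (i <= s)%N by rewrite -ltnS.
rewrite subSS coef_poly ltnS (leq_trans (leq_subr _ _) sN) subKn// IH ?(leq_trans is_)//.
rewrite -mulr_natr mulrACA (mulrC (c (s - i)%N)) -(cE s i is_); ring.
Qed.

Definition jump_poly (R : nzRingType) (k : nat) (lambda : 'I_k -> R) : {poly R} :=
  \sum_(j < k) lambda j *: 'X^(j.+1).

(** Every jump has size at least 1, so s jumps reach at least s. *)
Lemma jump_polyX_low (R : comNzRingType) (k : nat) (lambda : 'I_k -> R) (s n : nat) :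
  (n < s)%N -> (jump_poly lambda ^+ s)`_n = 0.
Proof.
have -> : jump_poly lambda = (\sum_(j < k) lambda j *: 'X^(j : nat)) * 'X.
  by rewrite mulr_suml; apply: eq_bigr => j _; rewrite [in LHS]exprSr scalerAl.
by move=> ns; rewrite exprMn coefMXn ns.
Qed.

Lemma Omega_sum_le (k n : nat) (x : {ffun 'I_k -> 'I_n.+1}) :
  x \in Omega k n -> (\sum_(j < k) x j <= n)%N.
Proof.
rewrite inE => /eqP xn; rewrite -[leqRHS]xn; apply: leq_sum => j _.
by rewrite mulSn leq_addr.
Qed.

Lemma coef_jump_polyX (R : numFieldType) (k : nat) (lambda : 'I_k -> R) (s n : nat) :
  (s <= n)%N ->
  (jump_poly lambda ^+ s)`_n / s`!%:R =
  \sum_(x in Omega k n | (\sum_(j < k) x j)%N == s)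
     \prod_(j < k) (lambda j ^+ x j / (x j)`!%:R).
Proof.
move=> sn.
(* Two variables: the outer one counts the number of jumps, the inner one the
   total jump size. *)
have := @coef_prod_expsum {poly R} (fun i => (i`!%:R^-1)%:P) _
  (fun j : 'I_k => lambda j *: 'X^(j.+1)) n s _ sn.
move=> /(_ _)/(congr1 (fun p : {poly R} => p`_n)).
rewrite coefCM mulrC => <-; last first.
  move=> m; rewrite -polyC_natr -polyCM divff// pnatr_eq0 -lt0n fact_gt0 //.
under eq_bigr => j _ do rewrite poly_def.
rewrite bigA_distr_bigA /= !coef_sum.
rewrite (big_mkcond (fun x => (x \in Omega k n) && _)) /=.
apply: eq_bigr => x _.
rewrite scaler_prod -expr_sum coefZ coefXn.
rewrite (eq_bigr (fun j : 'I_k => (lambda j ^+ x j / (x j)`!%:R)%:P *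
    'X^(j.+1 * x j))); last first.
  by move=> j _; rewrite exprZn -exprM polyCM -mul_polyC mulrA (mulrC (_ %:P)).
rewrite big_split /= -expr_sum -rmorph_prod -mulrA mulr_natr coefCM coefMn coefXn.
rewrite inE eq_sym [s == _]eq_sym.
by case: eqP => _; case: eqP => _; rewrite ?mulr1 ?mulr0.
Qed.

(** Any sum over Omega whose terms depend on x only through the multinomial weight
    and the number of jumps becomes a single sum over that number. *)
Lemma sum_Omega (R : numFieldType) (k : nat) (lambda : 'I_k -> R) (n : nat)
    (phi : nat -> R) :
  \sum_(x in Omega k n) (\prod_(j < k) (lambda j ^+ x j / (x j)`!%:R)) *
     phi (\sum_(j < k) x j)%N =
  \sum_(s < n.+1) (jump_poly lambda ^+ s)`_n / s`!%:R * phi s.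
Proof.
rewrite [RHS](eq_bigr (fun s : 'I_n.+1 =>
    \sum_(x in Omega k n | (\sum_(j < k) x j)%N == s)
      \prod_(j < k) (lambda j ^+ x j / (x j)`!%:R) * phi s)); last first.
  by move=> s _; rewrite coef_jump_polyX ?mulr_suml// -ltnS.
rewrite (exchange_big_dep (fun x => x \in Omega k n))/=; last by move=> ? ? _ /andP[].
apply: eq_bigr => x xO.
have sn : (\sum_(j < k) x j < n.+1)%N by rewrite ltnS Omega_sum_le.
by rewrite (big_pred1 (Ordinal sn))// => s /=; rewrite xO /= eq_sym.
Qed.

(** * Power series *)

(** The radius of convergence of the power series with coefficients c is at least r.
    In this form the property passes to the formal derivative without a limit. *)
Definition pbounded {R : realType} (c : nat -> R) (r : R) : Prop :=
  forall y, 0 < y -> y < r -> exists C, forall s, `|c s| * y ^+ s <= C.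

Lemma is_cvg_pseries_pbounded (R : realType) (c : nat -> R) (r x : R) :
  pbounded c r -> `|x| < r -> cvgn (pseries c x).
Proof.
move=> cr xr; pose y := (`|x| + r) / 2.
have [xy yr] : `|x| < y /\ y < r by rewrite /y; split; lra.
have y0 : 0 < y by rewrite (le_lt_trans _ xy).
have [C cC] := cr y y0 yr.
apply: normed_cvg; rewrite /normed_series_of /=.
apply: (@series_le_cvg _ _ (geometric C (`|x| / y))) => [s//|s|s|].
- have C0 : 0 <= C by rewrite (le_trans _ (cC 0%N))// mulr_ge0.
  by rewrite geometric_ge0// divr_ge0// ltW.
- have -> : `|c s * x ^+ s| = `|c s| * y ^+ s * (`|x| / y) ^+ s.
    by rewrite normrM normrX -mulrA -exprMn mulrC (mulrC y) divfK ?gt_eqF// mulrC.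
  by rewrite /= ler_wpM2r// exprn_ge0// divr_ge0// ltW.
apply: is_cvg_geometric_series.
by rewrite normrM normr_id normfV (ger0_norm (ltW y0)) ltr_pdivrMr ?mul1r.
Qed.

(** Each of the s + 1 powers x^0, ..., x^s is at least x^s, and they sum to at most
    1 / (1 - x). *)
Lemma natrX_bounded (R : realType) (x : R) (s : nat) : 0 <= x -> x < 1 ->
  s.+1%:R * x ^+ s <= (1 - x)^-1.
Proof.
move=> x0 x1; rewrite -[leRHS]mul1r ler_pdivlMr ?subr_gt0//.
apply: (@le_trans _ _ ((\sum_(i < s.+1) x ^+ i) * (1 - x))).
  rewrite ler_wpM2r ?subr_ge0 ?(ltW x1)//.
  rewrite mulr_natl -[X in _ *+ X]card_ord -sumr_const ler_sum// => i _.
  by rewrite ler_wiXn2l ?(ltW x1)//; case: i.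
rewrite mulrC -opprB mulNr -subrX1 opprB gerBl exprn_ge0//.
Qed.

Lemma pbounded_diffs (R : realType) (c : nat -> R) (r : R) :
  pbounded c r -> pbounded (pseries_diffs c) r.
Proof.
move=> cr x x0 xr; pose y := (x + r) / 2.
have [xy yr] : x < y /\ y < r by rewrite /y; split; lra.
have y0 : 0 < y by rewrite (lt_trans _ xy).
have [C cC] := cr y y0 yr.
(* The factor s + 1 is absorbed by the geometric decay of (x / y)^s. *)
exists ((1 - x / y)^-1 * (C / y)) => s.
rewrite /pseries_diffs normrM normr_nat.
have -> : s.+1%:R * `|c s.+1| * x ^+ s =
  (s.+1%:R * (x / y) ^+ s) * (`|c s.+1| * y ^+ s.+1 / y).
  rewrite expr_div_n exprS; field.
  by rewrite !gt_eqF// exprn_gt0.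
apply: ler_pM => //.
- by rewrite mulr_ge0// exprn_ge0// divr_ge0// ltW.
- by rewrite divr_ge0 ?(ltW y0)// mulr_ge0// exprn_ge0// ltW.
- by apply: natrX_bounded; rewrite ?ltr_pdivrMr ?mul1r// divr_ge0// ltW.
- by rewrite ler_pM2r ?invr_gt0.
Qed.

Lemma is_derive_pseries (R : realType) (c : nat -> R) (r x : R) :
  pbounded c r -> `|x| < r ->
  is_derive x 1 (fun y => limn (pseries c y)) (limn (pseries (pseries_diffs c) x)).
Proof.
move=> cr xr; pose K := (`|x| + r) / 2.
have [xy yr] : `|x| < K /\ K < r by rewrite /K; split; lra.
have K0 : `|K| = K by rewrite ger0_norm// (le_trans _ (ltW xy)).
apply: (@pseries_snd_diffs _ c K); rewrite ?K0//;
  apply: (@is_cvg_pseries_pbounded _ _ r); rewrite ?K0//.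
- exact: pbounded_diffs.
- by do 2! apply: pbounded_diffs.
Qed.

Lemma cvg_pseriesD (R : realType) (c1 c2 : nat -> R) (k1 k2 x : R) :
  cvgn (pseries c1 x) -> cvgn (pseries c2 x) ->
  pseries (fun i => k1 * c1 i + k2 * c2 i) x @ \oo -->
  k1 * limn (pseries c1 x) + k2 * limn (pseries c2 x).
Proof.
move=> h1 h2.
have -> : pseries (fun i => k1 * c1 i + k2 * c2 i) x =
    (fun n => k1 * pseries c1 x n + k2 * pseries c2 x n).
  apply/funext => n; rewrite /pseries /series /= !mulr_sumr -big_split /=.
  by apply: eq_bigr => i _; ring.
by apply: cvgD; apply: cvgMr.
Qed.

Lemma limn_pseriesD (R : realType) (c1 c2 : nat -> R) (k1 k2 x : R) :
  cvgn (pseries c1 x) -> cvgn (pseries c2 x) ->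
  limn (pseries (fun i => k1 * c1 i + k2 * c2 i) x) =
  k1 * limn (pseries c1 x) + k2 * limn (pseries c2 x).
Proof. by move=> h1 h2; apply: cvg_lim => //; exact: cvg_pseriesD. Qed.

Lemma limn_pseriesZ (R : realType) (c : nat -> R) (k x : R) :
  cvgn (pseries c x) ->
  limn (pseries (fun i => k * c i) x) = k * limn (pseries c x).
Proof.
move=> h; have := limn_pseriesD k 0 h h; rewrite mul0r addr0 => <-.
by congr (limn (pseries _ _)); apply/funext => i; rewrite mul0r addr0.
Qed.

Lemma limn_pseries_recl (R : realType) (c : nat -> R) (x : R) :
  cvgn (pseries c x) -> cvgn (pseries (fun i => c i.+1) x) ->
  limn (pseries c x) = c 0%N + x * limn (pseries (fun i => c i.+1) x).
Proof.
move=> h1 h2.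
apply: cvg_lim => //.
rewrite -cvg_shiftS /=.
have -> : (fun n => pseries c x n.+1) =
    (fun n => c 0%N + x * pseries (fun i => c i.+1) x n).
  apply/funext => n; rewrite /pseries /series /= big_nat_recl// expr0 mulr1.
  congr (_ + _); rewrite mulr_sumr; apply: eq_bigr => i _.
  by rewrite exprS; ring.
by apply: cvgD; [exact: cvg_cst|apply: cvgMr].
Qed.

(** r (r + 1) ... (r + s - 1) / s!, the coefficients of (1 - z)^(-r). *)
Definition rising_coeff {R : realType} (r : R) (s : nat) : R :=
  \prod_(i < s) ((r + i%:R) / i.+1%:R).

Lemma rising_coeff_ge0 (R : realType) (r : R) s : 0 <= r -> 0 <= rising_coeff r s.
Proof. by move=> r0; apply: prodr_ge0 => i _; rewrite divr_ge0// addr_ge0. Qed.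

Lemma rising_coeffS (R : realType) (r : R) s :
  s.+1%:R * rising_coeff r s.+1 = (r + s%:R) * rising_coeff r s.
Proof. by rewrite /rising_coeff big_ord_recr /=; field. Qed.

(** The ratio of consecutive terms tends to y < 1, so the terms eventually decrease. *)
Lemma pbounded_rising_coeff (R : realType) (r : R) : 0 <= r ->
  pbounded (rising_coeff r) 1.
Proof.
move=> r0 y y0 y1.
have [n nP] : exists n : nat, r * y / (1 - y) <= n%:R.
  exists (Num.truncn (r * y / (1 - y))).+1; apply: ltW.
  exact: truncnS_gt.
pose u s := rising_coeff r s * y ^+ s.
have u0 s : 0 <= u s.
  by rewrite mulr_ge0 ?rising_coeff_ge0// exprn_ge0// ltW.
have uS s : (n <= s)%N -> u s.+1 <= u s.
  move=> ns.
  have -> : u s.+1 = u s * ((r + s%:R) * y / s.+1%:R).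
    rewrite /u exprS -(mulKf (_ : s.+1%:R != 0) (rising_coeff r s.+1))//.
    by rewrite rising_coeffS; field; rewrite ?nat1r.
  rewrite ler_piMr// ler_pdivrMr// mul1r.
  have : r * y / (1 - y) <= s%:R by rewrite (le_trans nP)// ler_nat.
  rewrite ler_pdivrMr ?subr_gt0// => h.
  rewrite -natr1; nra.
exists (\sum_(i < n.+1) u i) => s.
rewrite ger0_norm ?rising_coeff_ge0// -/(u s).
have le_sum i : (i <= n)%N -> u i <= \sum_(i < n.+1) u i.
  move=> i_n; rewrite (bigD1 (Ordinal (i_n : (i < n.+1)%N)))//= lerDl sumr_ge0//.
have [/le_sum//|/ltnW ns] := leqP s n.
rewrite -(subnKC ns); elim: (s - n)%N => [|m IH]; first by rewrite addn0 le_sum.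
by rewrite addnS (le_trans _ IH)// uS// leq_addr.
Qed.

Lemma pboundedM (R : realType) (c e : nat -> R) (r q : R) : 0 < q ->
  pbounded c r -> (forall s, `|e s| <= q ^+ s) ->
  pbounded (fun s => c s * e s) (r / q).
Proof.
move=> q0 cr eq y y0 yrq.
have qyr : q * y < r by move: yrq; rewrite ltr_pdivlMr// mulrC.
have [C cC] := cr (q * y) (mulr_gt0 q0 y0) qyr.
exists C => s; rewrite (le_trans _ (cC s))// normrM -mulrA ler_wpM2l// exprMn.
by rewrite ler_wpM2r// exprn_ge0// ltW.
Qed.

Lemma pbounded_inv (R : realType) : pbounded (fun s => s%:R^-1 : R) 1.
Proof.
move=> y y0 y1; exists 1 => s.
rewrite ger0_norm ?invr_ge0// mulr_ile1 ?invr_ge0 ?exprn_ge0 ?exprn_ile1 ?(ltW y0) ?(ltW y1)//.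
by case: s => [|s]; rewrite ?invr0// invf_le1 ?ltr0n// ler1n.
Qed.

Lemma is_derive0_itv (R : realType) (f : R -> R) :
  (forall x : R, 0 <= x -> x <= 1 -> is_derive x 1 f 0) -> f 1 = f 0.
Proof.
move=> fd.
have [||c _] := @MVT_segment _ f (fun=> 0) 0 1 ler01.
- by move=> x; rewrite in_itv/= => /andP[x0 x1]; apply: fd; exact: ltW.
- apply: derivable_within_continuous => x; rewrite in_itv/= => /andP[x0 x1].
  by have := fd x x0 x1 => -[].
by rewrite mul0r => /eqP; rewrite subr_eq0 => /eqP.
Qed.

(** Here u_s + i v_s stands for w^s with |w| <= q < 1.  With G(x) = sum_s (rising
    coefficient) (x w)^s and l(x) = sum_(s >= 1) (x w)^s / s, the recurrences of the
    coefficients give (1 - x w) G' = r w G and (1 - x w) l' = w, hence G' = r l' G: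
    the function exp(- r l) G is constant on [0, 1], and it is 1 at 0. *)
Section binomial_series.
Context {R : realType}.
Variables (r q : R) (u v : nat -> R).
Hypothesis r_ge0 : 0 <= r.
Hypothesis q_gt0 : 0 < q.
Hypothesis q_lt1 : q < 1.
Hypothesis u0 : u 0%N = 1.
Hypothesis v0 : v 0%N = 0.
Hypothesis uS : forall s, u s.+1 = u 1%N * u s - v 1%N * v s.
Hypothesis vS : forall s, v s.+1 = u 1%N * v s + v 1%N * u s.
Hypothesis uq : forall s, `|u s| <= q ^+ s.
Hypothesis vq : forall s, `|v s| <= q ^+ s.

Let c1 s := rising_coeff r s * u s.
Let c2 s := rising_coeff r s * v s.
Let l1 s := s%:R^-1 * u s.
Let l2 s := s%:R^-1 * v s.
Let S (c : nat -> R) x := limn (pseries c x).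

Let c1b : pbounded c1 (1 / q).
Proof. by apply: pboundedM => //; exact: pbounded_rising_coeff. Qed.
Let c2b : pbounded c2 (1 / q).
Proof. by apply: pboundedM => //; exact: pbounded_rising_coeff. Qed.
Let l1b : pbounded l1 (1 / q).
Proof. by apply: pboundedM => //; exact: pbounded_inv. Qed.
Let l2b : pbounded l2 (1 / q).
Proof. by apply: pboundedM => //; exact: pbounded_inv. Qed.

Let SD e1 e2 k1 k2 x : pbounded e1 (1 / q) -> pbounded e2 (1 / q) ->
   `|x| < 1 / q ->
  S (fun s => k1 * e1 s + k2 * e2 s) x = k1 * S e1 x + k2 * S e2 x.
Proof.
by move=> h1 h2 xq; apply: limn_pseriesD; apply: (@is_cvg_pseries_pbounded _ _ (1 / q)).
Qed.

Let pboundedD e1 e2 k1 k2 : pbounded e1 (1 / q) -> pbounded e2 (1 / q) ->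
  pbounded (fun s => k1 * e1 s + k2 * e2 s) (1 / q) :> Prop.
Proof.
move=> h1 h2 y y0 yq; have [C1 h1'] := h1 y y0 yq; have [C2 h2'] := h2 y y0 yq.
exists (`|k1| * C1 + `|k2| * C2) => s.
apply: (@le_trans _ _ (`|k1| * (`|e1 s| * y ^+ s) + `|k2| * (`|e2 s| * y ^+ s))).
  rewrite !mulrA -mulrDl -!normrM ler_wpM2r ?ler_normD// exprn_ge0// ltW//.
by apply: lerD; apply: ler_wpM2l.
Qed.

(* The formal operator x d/dx. *)
Let Smul c x : pbounded c (1 / q) -> `|x| < 1 / q ->
  pbounded (fun s => s%:R * c s) (1 / q) /\
  S (fun s => s%:R * c s) x = x * S (pseries_diffs c) x.
Proof.
move=> cb xq.
have h : pbounded (fun s => s%:R * c s) (1 / q).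
  move=> y y0 yq; have [C hC] := pbounded_diffs cb y0 yq.
  exists (C * y) => -[|s]; first rewrite mul0r normr0 mul0r.
    by rewrite mulr_ge0 ?(ltW y0)// (le_trans _ (hC 0%N))// mulr_ge0// exprn_ge0// ltW.
  by have := hC s; rewrite /pseries_diffs exprSr mulrA ler_pM2r.
split => //; rewrite /S limn_pseries_recl ?mul0r ?add0r//.
  exact: is_cvg_pseries_pbounded h xq.
exact: is_cvg_pseries_pbounded (pbounded_diffs cb) xq.
Qed.

Let ode x : 0 <= x -> x <= 1 ->
  let U := S (pseries_diffs l1) x in
  let V := S (pseries_diffs l2) x in
  S (pseries_diffs c1) x = r * (U * S c1 x - V * S c2 x) /\
  S (pseries_diffs c2) x = r * (U * S c2 x + V * S c1 x).
Proof.
move=> x0 x1 U V.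
have xq : `|x| < 1 / q.
  by rewrite ger0_norm// (le_lt_trans x1)// ltr_pdivlMr// mul1r.
set p1 := u 1%N; set p2 := v 1%N.
have [m1b m1E] := Smul c1b xq; have [m2b m2E] := Smul c2b xq.
have [n1b n1E] := Smul l1b xq; have [n2b n2E] := Smul l2b xq.
set A := S c1 x; set B := S c2 x.
set A' := S (pseries_diffs c1) x; set B' := S (pseries_diffs c2) x.
have eA : A' = r * (p1 * A - p2 * B) + x * (p1 * A' - p2 * B').
  transitivity (S (fun s => r * (p1 * c1 s + (- p2) * c2 s) +
     1 * (p1 * (s%:R * c1 s) + (- p2) * (s%:R * c2 s))) x).
    congr S; apply/funext => s.
    rewrite /pseries_diffs /c1 /c2 mulrA rising_coeffS uS -/p1 -/p2; ring.
  rewrite SD//; [|exact: pboundedD|exact: pboundedD].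
  rewrite SD// SD// m1E m2E -/A -/B -/A' -/B'; ring.
have eB : B' = r * (p1 * B + p2 * A) + x * (p1 * B' + p2 * A').
  transitivity (S (fun s => r * (p1 * c2 s + p2 * c1 s) +
     1 * (p1 * (s%:R * c2 s) + p2 * (s%:R * c1 s))) x).
    congr S; apply/funext => s.
    rewrite /pseries_diffs /c1 /c2 mulrA rising_coeffS vS -/p1 -/p2; ring.
  rewrite SD//; [|exact: pboundedD|exact: pboundedD].
  rewrite SD// SD// m1E m2E -/A -/B -/A' -/B'; ring.
have dl1 : pseries_diffs l1 = (fun s => u s.+1).
  by apply/funext => s; rewrite /pseries_diffs /l1 mulrA divff ?mul1r.
have dl2 : pseries_diffs l2 = (fun s => v s.+1).
  by apply/funext => s; rewrite /pseries_diffs /l2 mulrA divff ?mul1r.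
have b1 := pbounded_diffs l1b; have b2 := pbounded_diffs l2b.
have eU : U = p1 + x * (p1 * U - p2 * V).
  have e : (fun s => u s.+2) = (fun s => p1 * pseries_diffs l1 s + (- p2) * pseries_diffs l2 s).
    by apply/funext => s; rewrite dl1 dl2 uS mulNr.
  rewrite {1}/U dl1 /S limn_pseries_recl.
  - by rewrite e -/(S _ _) SD// -/U -/V mulNr.
  - by rewrite -dl1; exact: is_cvg_pseries_pbounded b1 xq.
  - by rewrite e; exact: is_cvg_pseries_pbounded (pboundedD _ _ b1 b2) xq.
have eV : V = p2 + x * (p1 * V + p2 * U).
  have e : (fun s => v s.+2) = (fun s => p1 * pseries_diffs l2 s + p2 * pseries_diffs l1 s).
    by apply/funext => s; rewrite dl1 dl2 vS.
  rewrite {1}/V dl2 /S limn_pseries_recl.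
  - by rewrite e -/(S _ _) SD.
  - by rewrite -dl2; exact: is_cvg_pseries_pbounded b2 xq.
  - by rewrite e; exact: is_cvg_pseries_pbounded (pboundedD _ _ b2 b1) xq.
(* The squared modulus of 1 - x w, by which D1 + i D2 has to be divided. *)
have N0 : 0 < (1 - x * p1) ^+ 2 + (x * p2) ^+ 2.
  rewrite ltr_wpDr ?sqr_ge0// exprn_gt0// subr_gt0.
  rewrite (le_lt_trans (ler_norm _))// normrM ger0_norm//.
  rewrite (le_lt_trans _ q_lt1)// -[leRHS]mul1r ler_pM//.
  by have := uq 1; rewrite expr1.
have eA' : A' - x * (p1 * A' - p2 * B') = r * (p1 * A - p2 * B).
  by rewrite {1}eA addrK.
have eB' : B' - x * (p1 * B' + p2 * A') = r * (p1 * B + p2 * A).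
  by rewrite {1}eB addrK.
have eU' : U - x * (p1 * U - p2 * V) = p1 by rewrite {1}eU addrK.
have eV' : V - x * (p1 * V + p2 * U) = p2 by rewrite {1}eV addrK.
set D1 := A' - r * (U * A - V * B); set D2 := B' - r * (U * B + V * A).
have h1 : (1 - x * p1) * D1 + x * p2 * D2 = 0.
  rewrite /D1 /D2.
  transitivity ((A' - x * (p1 * A' - p2 * B')) - r * ((U - x * (p1 * U - p2 * V)) * A - (V - x * (p1 * V + p2 * U)) * B)); first ring.
  rewrite eA' eU' eV'; ring.
have h2 : (1 - x * p1) * D2 - x * p2 * D1 = 0.
  rewrite /D1 /D2.
  transitivity ((B' - x * (p1 * B' + p2 * A')) - r * ((U - x * (p1 * U - p2 * V)) * B + (V - x * (p1 * V + p2 * U)) * A)); first ring.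
  rewrite eB' eU' eV'; ring.
split; apply/eqP; rewrite -subr_eq0.
  rewrite -/D1 -(mulrI_eq0 _ (mulfI (lt0r_neq0 N0))); apply/eqP.
  transitivity ((1 - x * p1) * ((1 - x * p1) * D1 + x * p2 * D2) - x * p2 * ((1 - x * p1) * D2 - x * p2 * D1)); first ring.
  by rewrite h1 h2; ring.
rewrite -/D2 -(mulrI_eq0 _ (mulfI (lt0r_neq0 N0))); apply/eqP.
transitivity ((1 - x * p1) * ((1 - x * p1) * D2 - x * p2 * D1) + x * p2 * ((1 - x * p1) * D1 + x * p2 * D2)); first ring.
by rewrite h1 h2; ring.
Qed.

Lemma binomial_series :
  let L1 := limn (pseries (fun s => s%:R^-1 * u s) 1) in
  let L2 := limn (pseries (fun s => s%:R^-1 * v s) 1) in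
  limn (pseries (fun s => rising_coeff r s * u s) 1) = expR (r * L1) * cos (r * L2) /\
  limn (pseries (fun s => rising_coeff r s * v s) 1) = expR (r * L1) * sin (r * L2).
Proof.
move=> L1 L2.
(* The real and imaginary parts of exp(- r l) G. *)
pose C x := expR (- (r * S l1 x)) * (S c1 x * cos (r * S l2 x) + S c2 x * sin (r * S l2 x)).
pose D x := expR (- (r * S l1 x)) * (S c2 x * cos (r * S l2 x) - S c1 x * sin (r * S l2 x)).
have xq x : 0 <= x -> x <= 1 -> `|x| < 1 / q.
  by move=> x0 x1; rewrite ger0_norm// (le_lt_trans x1)// ltr_pdivlMr// mul1r.
have C1 : C 1 = C 0.
  apply: is_derive0_itv => x x0 x1.
  have [e1 e2] := ode x0 x1; have xx := xq x x0 x1.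
  have d1 := is_derive_pseries c1b xx; have d2 := is_derive_pseries c2b xx.
  have d3 := is_derive_pseries l1b xx; have d4 := is_derive_pseries l2b xx.
  apply: trigger_derive.
  rewrite /GRing.scale /= -!/(S _ _) e1 e2.
  ring.
have D1 : D 1 = D 0.
  apply: is_derive0_itv => x x0 x1.
  have [e1 e2] := ode x0 x1; have xx := xq x x0 x1.
  have d1 := is_derive_pseries c1b xx; have d2 := is_derive_pseries c2b xx.
  have d3 := is_derive_pseries l1b xx; have d4 := is_derive_pseries l2b xx.
  apply: trigger_derive.
  rewrite /GRing.scale /= -!/(S _ _) e1 e2.
  ring.
have S0 c : S c 0 = c 0%N.
  apply: cvg_lim => //; apply/cvgrPdist_le => e e0; near=> n.
  have n0 : (0 < n)%N by near: n; exact: nbhs_infty_gt.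
  rewrite /pseries /series /= -(prednK n0) big_nat_recl// expr0 mulr1 big1; last first.
    by move=> i _; rewrite expr0n mulr0.
  by rewrite addr0 subrr normr0 ltW.
have {}C1 : C 1 = 1.
  rewrite C1 /C !S0 /c1 /c2 /l1 /l2 u0 v0 /rising_coeff big_ord0.
  by rewrite !(mulr0, invr0, mul0r, oppr0, expR0, cos0, sin0, subr0, addr0, mulr1).
have {}D1 : D 1 = 0.
  rewrite D1 /D !S0 /c1 /c2 /l1 /l2 u0 v0 /rising_coeff big_ord0.
  by rewrite !(mulr0, invr0, mul0r, oppr0, expR0, cos0, sin0, subr0, addr0, mulr1).
have cs := cos2Dsin2 (r * L2).
have E : expR (r * L1) * expR (- (r * L1)) = 1 by rewrite expRxMexpNx_1.
set a := cos _ in cs *; set b := sin _ in cs *.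
split.
  transitivity (expR (r * L1) * (a * C 1 - b * D 1)); last by rewrite C1 D1; ring.
  transitivity (expR (r * L1) * expR (- (r * L1)) * (a ^+ 2 + b ^+ 2) * S c1 1).
    by rewrite E cs !mul1r.
  rewrite /C /D -/L1 -/L2 -/a -/b; ring.
transitivity (expR (r * L1) * (b * C 1 + a * D 1)); last by rewrite C1 D1; ring.
transitivity (expR (r * L1) * expR (- (r * L1)) * (a ^+ 2 + b ^+ 2) * S c2 1).
  by rewrite E cs !mul1r.
rewrite /C /D -/L1 -/L2 -/a -/b; ring.
Unshelve. all: by end_near.
Qed.
End binomial_series.

(** * Gamma integrals *)

Definition gamma_kernel {R : realType} (r c x : R) : R := x `^ (r - 1) * expR (- (c * x)).

Lemma gamma_kernel_ge0 (R : realType) (r c x : R) : 0 <= gamma_kernel r c x.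
Proof. by rewrite mulr_ge0 ?powR_ge0 ?expR_ge0. Qed.

Lemma measurable_gamma_kernel (R : realType) (r c : R) (D : set R) :
  measurable_fun D (gamma_kernel r c).
Proof.
apply: measurable_funTS; apply: measurable_funM.
  exact: measurable_powR.
by apply: measurableT_comp => //; apply: measurableT_comp => //.
Qed.

(** As x <= A exp(x / A) with A = 2 r / c, the power x^r is at most
    A^r exp(c x / 2). *)
Lemma powR_expR_cvgy (R : realType) (r c : R) : 0 < r -> 0 < c ->
  (x `^ r * expR (- (c * x))) @[x --> +oo] --> (0 : R).
Proof.
move=> r0 c0; pose K := (2 * r / c) `^ r.
have c2 : 0 < c / 2 by rewrite divr_gt0.
have rc : 0 < 2 * r / c by rewrite divr_gt0// mulr_gt0.
apply: (@squeeze_cvgr _ _ _ _ (fun=> 0) (fun x => K * expR (- (x * (c / 2))))).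
- near=> x.
  have x0 : 0 < x by near: x; exact: nbhs_pinfty_gt.
  rewrite mulr_ge0 ?powR_ge0 ?expR_ge0//=.
  have xle : x <= 2 * r / c * expR (c * x / (2 * r)).
    rewrite -ler_pdivrMl// invf_div mulrAC.
    by rewrite (le_trans _ (expR_ge1Dx _))// lerDr.
  have -> : - (x * (c / 2)) = c * x / (2 * r) * r + - (c * x).
    by field; rewrite gt_eqF.
  rewrite expRD mulrA ler_wpM2r ?expR_ge0// expRM -powRM ?expR_ge0 ?(ltW rc)//.
  by rewrite ge0_ler_powR// ?nnegrE ?(ltW r0) ?(ltW x0)// mulr_ge0 ?expR_ge0// ltW.
- exact: cvg_cst.
rewrite -[X in _ --> X](mulr0 K); apply: cvgMr.
apply: (@cvg_comp _ _ _ (fun x => x * (c / 2)) (fun x => expR (- x))); last exact: cvgr_expR.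
by apply: gt0_cvgMly => //; exact: cvg_id.
Unshelve. all: by end_near. Qed.

Lemma gamma_kernel_by_parts (R : realType) (r c e N : R) :
  0 < r -> 0 < c -> 0 < e -> e < N ->
  (\int[lebesgue_measure]_(x in `[e, N]) (c * gamma_kernel (r + 1) c x)%:E =
  (- (N `^ r * expR (- (c * N))) + e `^ r * expR (- (c * e)))%:E +
  \int[lebesgue_measure]_(x in `[e, N]) (r * gamma_kernel r c x)%:E)%E.
Proof.
move=> r0 c0 e0 eN.
have ee x : x \in `[e, N] -> 0 < x.
  by rewrite in_itv/= => /andP[ex _]; rewrite (lt_le_trans e0).
have dexp (x : R) : is_derive x 1 (fun x => - expR (- (c * x))) (c * expR (- (c * x))).
  by apply: trigger_derive; rewrite /GRing.scale /= ; ring.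
have dpow s (x : R) : 0 < x -> derivable (fun x : R => x `^ s) x 1.
  by move=> x0; apply: derivable_powR; rewrite in_itv/= x0.
have cpow s : {within `[e, N], continuous (fun x : R => x `^ s)}.
  by apply: derivable_within_continuous => x /ee x0; exact: dpow.
have cc (f : R -> R) : (forall x, 0 < x -> derivable f x 1) -> derivable_oo_LRcontinuous f e N.
  move=> df; split.
  - by move=> x xi; apply/df/ee/(@subset_itv_oo_cc _ _ _ _ x xi).
  - by apply: cvg_at_right_filter; apply: differentiable_continuous; apply/derivable1_diffP; apply: df.
  - by apply: cvg_at_left_filter; apply: differentiable_continuous; apply/derivable1_diffP; apply: df; exact: lt_trans eN.
have := @integration_by_parts _ (fun x => x `^ r) (fun x => - expR (- (c * x)))
  (fun x => r * x `^ (r - 1)) (fun x => c * expR (- (c * x))) e N eN.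
have h1 : {within `[e, N], continuous (fun x : R => r * x `^ (r - 1))}.
  apply: derivable_within_continuous => x /ee x0.
  by apply: derivableM => //; exact: dpow.
have h2 : derivable_oo_LRcontinuous (fun x : R => x `^ r) e N.
  by apply: cc => x; exact: dpow.
have h3 : {in `]e, N[, ((fun x : R => x `^ r)^`())%classic =1 (fun x => r * x `^ (r - 1))}.
  by move=> x xi; apply: powR_derive1; rewrite in_itv/= andbT; apply/ee/(@subset_itv_oo_cc _ _ _ _ x xi).
have h4 : {within `[e, N], continuous (fun x : R => c * expR (- (c * x)))}.
  apply: derivable_within_continuous => x _.
  have : is_derive x 1 (fun x : R => c * expR (- (c * x))) (- c ^+ 2 * expR (- (c * x))).
    by apply: trigger_derive; rewrite /GRing.scale /=; ring.
  by case.
have h5 : derivable_oo_LRcontinuous (fun x : R => - expR (- (c * x))) e N.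
  by apply: cc => x _; have [] := dexp x.
have h6 : {in `]e, N[, ((fun x : R => - expR (- (c * x)))^`())%classic =1 (fun x => c * expR (- (c * x)))}.
  by move=> x _; rewrite derive1E; exact: derive_val.
move=> /(_ h1 h2 h3 h4 h5 h6) H.
transitivity (\int[lebesgue_measure]_(x in `[e, N]) (x `^ r * (c * expR (- (c * x))))%:E)%E.
  apply: eq_integral => x _; rewrite /gamma_kernel addrK; congr EFin; ring.
rewrite H.
congr (_ + _)%E; first by congr EFin; ring.
transitivity (- \int[lebesgue_measure]_(x in `[e, N]) (- (r * gamma_kernel r c x)%:E))%E.
  congr (- _)%E.
  by apply: eq_integral => x _; rewrite /gamma_kernel -EFinN; congr EFin; ring.
rewrite integral_ge0N ?oppeK// => x _.
by rewrite lee_fin mulr_ge0 ?gamma_kernel_ge0// ltW.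
Qed.

(** The functional equation of the gamma function, with a scale c.  Integration by
    parts is done on [1/(n + 2), n + 2], where the integrands are continuous; the
    boundary terms vanish in the limit. *)
Lemma gamma_integralS (R : realType) (r c : R) : 0 < r -> 0 < c ->
  (c%:E * \int[lebesgue_measure]_(x in `]0%R, +oo[) (gamma_kernel (r + 1) c x)%:E =
   r%:E * \int[lebesgue_measure]_(x in `]0%R, +oo[) (gamma_kernel r c x)%:E)%E.
Proof.
move=> r0 c0.
pose I (n : nat) : set R := `[n.+2%:R^-1, n.+2%:R]%classic.
have I0 n x : I n x -> 0 < x.
  by rewrite /I /= in_itv/= => /andP[+ _]; apply: lt_le_trans; rewrite invr_gt0.
have UI : \bigcup_n I n = `]0%R, +oo[%classic.
  apply/seteqP; split => x /=; rewrite in_itv/= andbT.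
    by case=> n _; exact: I0.
  move=> x0; exists (maxn (Num.truncn x) (Num.truncn x^-1)) => //.
  rewrite /I /= in_itv/=; apply/andP; split.
    rewrite -[leRHS]invrK lef_pV2 ?posrE ?invr_gt0 ?ltr0n//.
    rewrite (le_trans (ltW (truncnS_gt _)))// ler_nat.
    by rewrite (leq_trans _ (leqnSn _))// ltnS leq_maxr.
  rewrite (le_trans (ltW (truncnS_gt _)))// ler_nat.
  by rewrite (leq_trans _ (leqnSn _))// ltnS leq_maxl.
have cvgI (f : R -> R) : measurable_fun setT f -> (forall x, 0 <= f x) ->
  (\int[lebesgue_measure]_(x in I n) (f x)%:E @[n --> \oo] -->
   \int[lebesgue_measure]_(x in `]0%R, +oo[) (f x)%:E)%E.
  move=> mf f0; rewrite -UI; apply: ge0_nondecreasing_set_cvg_integral.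
  - move=> n m nm; apply/subsetPset => x; rewrite /I /= !in_itv/= => /andP[h1 h2].
    apply/andP; split.
      by rewrite (le_trans _ h1)// lef_pV2 ?posrE ?ltr0n// ler_nat !ltnS.
    by rewrite (le_trans h2)// ler_nat !ltnS.
  - by move=> n; exact: measurable_itv.
  - by move=> n; apply/measurable_EFinP; exact: measurable_funTS.
  - by move=> n x _; rewrite lee_fin.
have mk s k : measurable_fun setT (fun x : R => s * gamma_kernel k c x).
  by apply: measurable_funM => //; exact: measurable_gamma_kernel.
have k0 s k : 0 < s -> forall x, 0 <= s * gamma_kernel k c x.
  by move=> s0 x; rewrite mulr_ge0 ?gamma_kernel_ge0// ltW.
have Zl s k : 0 < s ->
    (s%:E * \int[lebesgue_measure]_(x in `]0%R, +oo[) (gamma_kernel k c x)%:E =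
    \int[lebesgue_measure]_(x in `]0%R, +oo[) (s * gamma_kernel k c x)%:E)%E.
  move=> s0; rewrite -ge0_integralZl//=.
  - by apply/measurable_EFinP; exact: measurable_gamma_kernel.
  - by move=> x _; rewrite lee_fin gamma_kernel_ge0.
  - by rewrite lee_fin ltW.
rewrite (Zl c (r + 1) c0) (Zl r r r0).
have := cvgI _ (mk r r) (k0 _ r r0).
have := cvgI _ (mk c (r + 1)) (k0 _ (r + 1) c0).
move: (\int[lebesgue_measure]_(x in `]0%R, +oo[) (c * _)%:E)%E => A h1.
move: (\int[lebesgue_measure]_(x in `]0%R, +oo[) (r * _)%:E)%E => B h2.
suff h3 : (\int[lebesgue_measure]_(x in I n) (c * gamma_kernel (r + 1) c x)%:E)%E
  @[n --> \oo] --> B.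
  by rewrite -(cvg_lim _ h1)// (cvg_lim _ h3).
have E n : (\int[lebesgue_measure]_(x in I n) (c * gamma_kernel (r + 1) c x)%:E =
   (- (n.+2%:R `^ r * expR (- (c * n.+2%:R))) +
      n.+2%:R^-1 `^ r * expR (- (c * n.+2%:R^-1)))%:E +
   \int[lebesgue_measure]_(x in I n) (r * gamma_kernel r c x)%:E)%E.
  rewrite gamma_kernel_by_parts ?invr_gt0//.
  by rewrite (@lt_le_trans _ _ 1)// ?ler1n// invf_lt1 ?ltr1n.
rewrite (funext E) -(add0e B).
apply: cvgeD => //.
apply: cvg_EFin; first by near=> n.
have ty : (n.+2%:R : R) @[n --> \oo] --> +oo.
  apply/cvgryPge => A'; near=> n.
  rewrite (le_trans (ltW (truncnS_gt _)))// ler_nat.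
  by apply: (@leq_trans n); [near: n; exact: nbhs_infty_ge|rewrite -addn2 leq_addr].
have t0 : (n.+2%:R^-1 : R) @[n --> \oo] --> 0^'+.
  have t1 : (n.+2%:R^-1 : R) @[n --> \oo] --> 0.
    by apply/gtr0_cvgV0 => //; near=> n; rewrite ltr0n.
  move=> S /= [e /= e0 he]; move/cvgrPdist_lt : t1 => /(_ e e0).
  by apply: filterS => n /= h; apply: he; rewrite //= invr_gt0.
rewrite [X in _ --> X](_ : _ = - 0 + 0 * expR (- (c * 0))); last by rewrite mul0r oppr0 addr0.
apply: cvgD; first apply: cvgN.
  exact: (cvg_comp _ _ ty (powR_expR_cvgy r0 c0)).
apply: (@cvg_comp _ _ _ (fun n : nat => n.+2%:R^-1 : R) (fun x => x `^ r * expR (- (c * x))) _ _ _ t0).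
apply: cvgM; first exact: powR_cvg0.
apply: cvg_at_right_filter.
apply: continuous_comp; last exact: continuous_expR.
by apply: cvgN; apply: cvgMr; exact: cvg_id.
Unshelve. all: by end_near. Qed.

Lemma GammaS (R : realType) (s : nat) : Gamma (s.+1%:R : R) = s`!%:R.
Proof.
have E n : (\int[lebesgue_measure]_(x in `]0%R, +oo[) (gamma_kernel n.+1%:R 1 x)%:E =
    (n`!%:R : R)%:E)%E.
  elim: n => [|n IH].
    rewrite fact0 -(@integral_exponential_pdf R 1 ltr01).
    rewrite integral_itv_obnd_cbnd; last first.
      by apply/measurable_EFinP; exact: measurable_gamma_kernel.
    rewrite integral_mkcond; apply: eq_integral => x _.
    rewrite /exponential_pdf !patchE; case: ifP => // _.
    by rewrite /gamma_kernel subrr powRr0 !mul1r mulN1r.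
  have := @gamma_integralS R n.+1%:R 1 (ltr0Sn _ _) ltr01.
  by rewrite mul1e IH natr1 factS natrM EFinM.
rewrite /Gamma -[RHS]/(fine (s`!%:R)%:E) -E /Rintegral; congr fine.
by apply: eq_integral => x _; rewrite /gamma_kernel mul1r.
Qed.

(** * The law of a generalized counting process at a fixed time *)

Definition gcp_pmf {R : realType} (k : nat) (lambda : 'I_k -> R) (n : nat) (t : R) : R :=
  \sum_(s < n.+1) (jump_poly lambda ^+ s)`_n / s`!%:R *
    (t ^+ s * expR (- ((\sum_(j < k) lambda j) * t))).

Lemma measure_finType_bigcup (d : measure_display) (T : measurableType d) (R : realType)
    (mu : {measure set T -> \bar R}) (I : finType) (A : {set I}) (F : I -> set T) :
  (forall i, i \in A -> measurable (F i)) -> trivIset [set` A] F ->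
  mu (\bigcup_(i in [set` A]) F i) = (\sum_(i in A) mu (F i))%E.
Proof.
move=> mF tF; rewrite measure_fin_bigcup//.
rewrite -(@bigfs _ _ _ _ (index_enum I)) ?index_enum_uniq//.
by move=> i _; rewrite mem_index_enum.
Qed.

Lemma poisson_process_measurable (R : realType) (d : measure_display)
    (T : measurableType d) (P : probability T R) l (N : R -> T -> nat) t (A : set nat) :
  poisson_process P l N -> 0 <= t -> measurable (N t @^-1` A).
Proof.
move=> [[mN _ _ _] _ _] t0; rewrite -[_ @^-1` _]setTI; exact: mN.
Qed.

Lemma process_sigma_algebra_preimage (R : realType) (d d' : measure_display)
    (T : measurableType d) (S : measurableType d') (X : R -> T -> S) t (A : set S) :
  0 <= t -> measurable A -> process_sigma_algebra X (X t @^-1` A).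
Proof. by move=> t0 mA; apply: sub_sigma_algebra; exists t, A. Qed.

Lemma prod_poisson_pmf (R : realType) (k : nat) (lambda : 'I_k -> R) (t : R)
    (x : 'I_k -> nat) :
  (forall j, 0 < lambda j) -> 0 < t ->
  \prod_(j < k) poisson_pmf (lambda j * t) (x j) =
  \prod_(j < k) (lambda j ^+ x j / (x j)`!%:R) *
    (t ^+ (\sum_(j < k) x j) * expR (- ((\sum_(j < k) lambda j) * t))).
Proof.
move=> l0 t0; rewrite mulr_suml -sumrN expR_sum expr_sum -!big_split /=.
apply: eq_bigr => j _; rewrite /poisson_pmf mulr_gt0// exprMn; ring.
Qed.

(** The event M(t) = n is the disjoint union over x in Omega of the independent
    events N_1(t) = x_1, ..., N_k(t) = x_k. *)
Lemma gcp_law (R : realType) (d : measure_display) (T : measurableType d)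
    (P : probability T R) (k : nat) (lambda : 'I_k -> R) (M : R -> T -> nat)
    (t : R) (n : nat) :
  (forall j, 0 < lambda j) -> generalized_counting_process P lambda M -> 0 < t ->
  P [set w | M t w = n] = (gcp_pmf lambda n t)%:E.
Proof.
move=> l0 [_ [d' [T' [P' [N [NP Nind MN]]]]]] t0.
have := MN 1%N (fun=> t) (fun=> n) (fun=> ltW t0).
have -> : [set w | 'I_1 -> M t w = n] = [set w | M t w = n].
  by apply/seteqP; split => w /= h; [exact: h ord0|].
have -> : [set w | 'I_1 -> (\sum_(j < k) j.+1 * N j t w)%N = n] =
  \bigcup_(x in [set` Omega k n]) \bigcap_j (N j t @^-1` [set (x j : nat)]).
  apply/seteqP; split => w /=.
    move=> /(_ ord0) Nn.
    (* This bound lets the counts be read as an element of the finite type of Omega. *)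
    have Nle j : (N j t w < n.+1)%N.
      by rewrite ltnS -Nn (bigD1 j)//= mulSn -addnA leq_addr.
    exists [ffun j => Ordinal (Nle j)] => /=.
      rewrite inE; apply/eqP; rewrite -[RHS]Nn.
      by apply: eq_bigr => j _; rewrite ffunE.
    by move=> j _ /=; rewrite ffunE.
  move=> [x]; rewrite /= inE => /eqP xn Nx _.
  by rewrite -[RHS]xn; apply: eq_bigr => j _; rewrite (Nx j I).
move=> ->; rewrite measure_finType_bigcup; last 2 first.
- move=> x _; apply: fin_bigcap_measurable => // j _.
  exact: poisson_process_measurable (NP j) (ltW t0).
- move=> x y _ _ [w [/= xw yw]]; apply/ffunP => j; apply/val_inj => /=.
  by rewrite -(xw j I) -(yw j I).
rewrite /gcp_pmf -(sum_Omega lambda n (fun s => t ^+ s * expR (- ((\sum_(j < k) lambda j) * t)))).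
rewrite -sumEFin; apply: eq_bigr => x _.
apply: (etrans (Nind (fun j => N j t @^-1` [set (x j : nat)]) _)) => [j|].
  exact: process_sigma_algebra_preimage (ltW t0) _.
rewrite -prod_poisson_pmf// -prodEFin; apply: eq_bigr => j _.
by have [_ _ /(_ t (x j) t0)] := NP j.
Qed.

(** * Evaluating a counting process at an independent random time *)

(** The smallest multiple of 1/(n + 1) that is strictly above x, for x >= 0.  The
    approximation must be from the right, the side on which paths are continuous. *)
Definition grid {R : realType} (n : nat) (x : R) : R :=
  (Num.truncn (x * n.+1%:R)).+1%:R / n.+1%:R.

Lemma grid_gt (R : realType) n (x : R) : x < grid n x.
Proof. by rewrite /grid ltr_pdivlMr// truncnS_gt. Qed.

Lemma grid_le (R : realType) n (x : R) : 0 <= x -> grid n x <= x + n.+1%:R^-1.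
Proof.
move=> x0; rewrite /grid ler_pdivrMr// mulrDl mulVf// -natr1 lerD2r.
by rewrite truncn_le mulr_ge0.
Qed.

Lemma grid_gt0 (R : realType) n (x : R) : 0 < grid n x.
Proof. by rewrite divr_gt0. Qed.

Lemma cvg_grid (R : realType) (x : R) : 0 <= x -> grid n x @[n --> \oo] --> x^'+.
Proof.
move=> x0.
have t1 : grid n x @[n --> \oo] --> x.
  apply: (@squeeze_cvgr _ _ _ _ (fun=> x) (fun n => x + n.+1%:R^-1)).
  - by near=> n; rewrite (ltW (grid_gt n x)) grid_le.
  - exact: cvg_cst.
  rewrite -[X in _ --> X]addr0; apply: cvgD; first exact: cvg_cst.
  apply/gtr0_cvgV0; first by near=> n; rewrite ltr0n.
  apply/cvgryPge => A; near=> n.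
  rewrite (le_trans (ltW (truncnS_gt _)))// ler_nat ltnS.
  by near: n; exact: nbhs_infty_ge.
move=> S /= [e /= e0 he]; move/cvgrPdist_lt : t1 => /(_ e e0).
by apply: filterS => n /= h; apply: he => //; exact: grid_gt.
Unshelve. all: by end_near. Qed.

Definition grid_cell {R : realType} (n i : nat) : set R :=
  [set x | Num.truncn (x * n.+1%:R) = i].

Lemma measurable_grid_cell (R : realType) n i : measurable (@grid_cell R n i).
Proof.
have m j : measurable [set x : R | (j < Num.truncn (x * n.+1%:R)%R)%N].
  rewrite (_ : mkset _ = `[j.+1%:R / n.+1%:R, +oo[%classic)//.
  by apply/seteqP; split => x /=; rewrite in_itv/= andbT truncn_gt_nat ler_pdivrMr.
case: i => [|i].
  rewrite (_ : grid_cell _ _ = ~` [set x : R | (0 < Num.truncn (x * n.+1%:R)%R)%N]); last first.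
    by apply/seteqP; split => x /=; rewrite /grid_cell/=; [move=> ->|case: Num.truncn].
  exact: measurableC.
rewrite (_ : grid_cell _ _ = [set x : R | (i < Num.truncn (x * n.+1%:R)%R)%N] `\`
   [set x : R | (i.+1 < Num.truncn (x * n.+1%:R)%R)%N]); first exact: measurableD.
apply/seteqP; split => x /=; rewrite /grid_cell/=; first by move=> ->; rewrite ltnn.
by case=> h1 /negP; rewrite -leqNgt => h2; apply/eqP; rewrite eqn_leq h2.
Qed.

Lemma bigcup_grid_cell (R : realType) n : \bigcup_i (@grid_cell R n i) = setT.
Proof. by apply/seteqP; split => // x _; exists (Num.truncn (x * n.+1%:R)). Qed.

Lemma trivIset_grid_cell (R : realType) n : trivIset setT (@grid_cell R n).
Proof. by move=> i j _ _ [x [/= <- <-]]. Qed.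

Lemma gridE (R : realType) n i (x : R) : grid_cell n i x -> grid n x = i.+1%:R / n.+1%:R.
Proof. by rewrite /grid => ->. Qed.

Lemma measurable_grid (R : realType) n (D : set R) : measurable_fun D (@grid R n).
Proof.
apply: measurable_funTS => _ Y mY; rewrite setTI.
rewrite (_ : _ @^-1` _ = \bigcup_(i in [set i | Y (i.+1%:R / n.+1%:R)]) grid_cell n i).
  by apply: bigcup_measurable => i _; exact: measurable_grid_cell.
apply/seteqP; split => x /=.
  by move=> Yx; exists (Num.truncn (x * n.+1%:R)).
by move=> [i /= Yi /gridE ->].
Qed.

Section random_time.
Context {R : realType} {d : measure_display} {T : measurableType d}.
Variables (M : R -> T -> nat) (Z : T -> R).
Hypothesis mM : forall t, 0 <= t -> measurable_fun setT (M t).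
Hypothesis M_right : forall w t, 0 <= t ->
  ((M s w)%:R : R) @[s --> t^'+] --> ((M t w)%:R : R).
Hypothesis mZ : measurable_fun setT Z.
Hypothesis Z0 : forall w, 0 <= Z w.

Lemma preimage_grid n (A : set nat) :
  [set w | A (M (grid n (Z w)) w)] =
  \bigcup_i (M (i.+1%:R / n.+1%:R) @^-1` A `&` Z @^-1` grid_cell n i).
Proof.
apply/seteqP; split => w /=.
  by move=> Aw; exists (Num.truncn (Z w * n.+1%:R)).
by move=> [i _ [/= Mi /gridE ->]].
Qed.

Lemma measurable_preimage t (A : set nat) : 0 <= t -> measurable (M t @^-1` A).
Proof. by move=> t0; rewrite -[_ @^-1` _]setTI; exact: mM. Qed.

Lemma measurable_preimage_time (A : set R) : measurable A -> measurable (Z @^-1` A).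
Proof. by move=> mA; rewrite -[_ @^-1` _]setTI; exact: mZ. Qed.

Lemma measurable_grid_time n (A : set nat) : measurable [set w | A (M (grid n (Z w)) w)].
Proof.
rewrite preimage_grid; apply: bigcup_measurable => i _; apply: measurableI.
  by apply: measurable_preimage; rewrite divr_ge0.
by apply: measurable_preimage_time; exact: measurable_grid_cell.
Qed.

Lemma cvg_grid_time w : ((M (grid n (Z w)) w)%:R : R) @[n --> \oo] --> ((M (Z w) w)%:R : R).
Proof. exact: (cvg_comp _ _ (cvg_grid (Z0 w)) (M_right (Z0 w))). Qed.

Lemma near_grid_time w : \forall n \near \oo, M (grid n (Z w)) w = M (Z w) w.
Proof.
have /cvgrPdist_lt/(_ 1 ltr01) := @cvg_grid_time w.
apply: filterS => n; rewrite ltr_norml => /andP[h1 h2].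
by apply/eqP; rewrite eqn_leq; apply/andP; split; rewrite -ltnS -(ltr_nat R) -natr1; lra.
Qed.

Lemma measurable_random_time : measurable_fun setT (fun w => (M (Z w) w)%:R : R).
Proof.
apply: (@measurable_fun_cvg _ _ _ _ (fun n w => (M (grid n (Z w)) w)%:R)).
  move=> n _ Y mY; rewrite setTI; exact: (measurable_grid_time n [set m | Y m%:R]).
by move=> w _; exact: cvg_grid_time.
Qed.

Lemma measurable_random_time_nat (A : set nat) : measurable [set w | A (M (Z w) w)].
Proof.
rewrite (_ : mkset _ = (fun w => (M (Z w) w)%:R : R) @^-1` ((fun n => n%:R) @` A)).
  rewrite -[_ @^-1` _]setTI; apply: measurable_random_time => //.
  apply: countable_measurable; first by move=> x; exact: measurable_set1.
  exact: (sub_countable (card_image_le _ A)).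
apply/seteqP; split => w /=; first by move=> ?; exists (M (Z w) w).
by move=> [n An /eqP]; rewrite eqr_nat => /eqP <-.
Qed.

(** On the grid, M and Z interact only through the countably many independent pairs
    of events M(i/(m + 1)) = n and grid(Z) = i/(m + 1); this gives the formula with h
    evaluated at grid points.  Both sides pass to the limit by dominated convergence:
    the left one because integer-valued right-continuous paths are eventually constant
    along the grid, the right one because h is continuous and bounded by 1. *)
Lemma random_time_pmf (P : probability T R) (g h : R -> R) (n : nat) :
  (forall A, measurable A -> P (Z @^-1` A) = \int[lebesgue_measure]_(x in A) (g x)%:E)%E ->
  (forall x, 0 <= g x) -> (forall x, x <= 0 -> g x = 0) -> measurable_fun setT g ->
  measurable_fun setT h ->
  (forall t : R, 0 < t -> h x @[x --> t] --> h t) ->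
  (forall t, 0 < t -> P [set w | M t w = n] = (h t)%:E) ->
  (forall t A, 0 <= t -> measurable A ->
     P ([set w | M t w = n] `&` Z @^-1` A) = (P [set w | M t w = n] * P (Z @^-1` A))%E) ->
  (P [set w | M (Z w) w = n] = \int[lebesgue_measure]_x (h x * g x)%:E)%E.
Proof.
move=> PZ g0 gneg mg mh h_cont Ph ind.
have h01 t : 0 < t -> 0 <= h t <= 1.
  by move=> t0; rewrite -!lee_fin -Ph// measure_ge0 probability_le1//; exact: (measurable_preimage [set n] (ltW t0)).
have ig : (lebesgue_measure).-integrable setT (EFin \o g).
  apply/integrableP; split; first exact/measurable_EFinP.
  under eq_integral do rewrite /= ger0_norm//.
  by rewrite -PZ// preimage_setT probability_setT ltry.
have mhg m : measurable_fun setT (fun x => (h (grid m x) * g x)%:E).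
  apply/measurable_EFinP; apply: measurable_funM => //.
  by apply: measurableT_comp => //; exact: measurable_grid.
have E m : P [set w | M (grid m (Z w)) w = n] =
    (\int[lebesgue_measure]_x (h (grid m x) * g x)%:E)%E.
  have := preimage_grid m [set n] => /= ->.
  rewrite measure_semi_bigcup; last 3 first.
  - move=> i; apply: measurableI.
      by apply: (measurable_preimage [set n]); rewrite divr_ge0.
    by apply: measurable_preimage_time; exact: measurable_grid_cell.
  - move=> i j _ _ [w [[_ wi] [_ wj]]].
    by apply: (@trivIset_grid_cell R m i j I I); exists (Z w).
  - by have := measurable_grid_time m [set n]; rewrite preimage_grid.
  rewrite -[in RHS](bigcup_grid_cell R m) ge0_integral_bigcup//; last 4 first.
  - by move=> i; exact: measurable_grid_cell.
  - by apply: measurable_funTS; exact: (mhg m).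
  - by move=> x _; rewrite lee_fin mulr_ge0//; have /andP[] := h01 _ (grid_gt0 m x).
  - exact: trivIset_grid_cell.
  apply: eq_eseriesr => i _.
  have i0 : 0 < i.+1%:R / m.+1%:R :> R by rewrite divr_gt0.
  apply: (etrans (ind _ _ (ltW i0) (measurable_grid_cell m i))).
  rewrite (Ph _ i0).
  rewrite PZ; last exact: measurable_grid_cell.
  rewrite -ge0_integralZl//; last 4 first.
  - exact: measurable_grid_cell.
  - by apply/measurable_EFinP; exact: measurable_funTS.
  - by move=> x _; rewrite lee_fin.
  - by rewrite lee_fin; have /andP[] := h01 _ i0.
  by apply: eq_integral => x; rewrite inE => /gridE ->.
have L1 : P [set w | M (grid m (Z w)) w = n] @[m --> \oo] --> P [set w | M (Z w) w = n].
  have PE (A : set T) : measurable A -> P A = (\int[P]_w (\1_A w)%:E)%E.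
    by move=> mA; rewrite integral_indic// setIT.
  rewrite PE; last exact: (measurable_random_time_nat [set n]).
  under eq_fun do (rewrite PE; last exact: (measurable_grid_time _ [set n])).
  have [] := @dominated_convergence _ _ _ P setT measurableT
    (fun m w => (\1_[set w | M (grid m (Z w)) w = n] w)%:E)
    (fun w => (\1_[set w | M (Z w) w = n] w)%:E) (cst 1%E) => //.
  - by move=> m; apply/measurable_EFinP; apply: measurable_indic; exact: (measurable_grid_time _ [set n]).
  - by apply/measurable_EFinP; apply: measurable_indic; exact: (measurable_random_time_nat [set n]).
  - apply: aeW => w _; apply: cvg_near_cst.
    apply: filterS (near_grid_time w) => m /= e.
    by rewrite !indicE; congr ((nat_of_bool _)%:R%:E); apply/idP/idP; rewrite !inE /= e.
  - exact: finite_measure_integrable_cst.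
  - by apply: aeW => w m _; rewrite /= indicE lee_fin; case: (_ \in _); rewrite ?normr1 ?normr0.
have L2 : (\int[lebesgue_measure]_x (h (grid m x) * g x)%:E @[m --> \oo] -->
    \int[lebesgue_measure]_x (h x * g x)%:E)%E.
  have [] := @dominated_convergence _ _ _ lebesgue_measure setT measurableT
    (fun m x => (h (grid m x) * g x)%:E) (fun x => (h x * g x)%:E) (EFin \o g) => //.
  - by apply/measurable_EFinP; exact: measurable_funM.
  - apply: aeW => x _; have [x0|x0] := leP x 0.
      under eq_fun do rewrite gneg// mulr0.
      by rewrite gneg// mulr0; exact: cvg_cst.
    apply: cvg_EFin; first by near=> m.
    apply: cvgM; last exact: cvg_cst.
    apply: (cvg_comp _ _ (cvg_grid (ltW x0))).
    exact: cvg_at_right_filter (h_cont _ x0).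
  - apply: aeW => x m _ /=; have /andP[h0 h1] := h01 _ (grid_gt0 m x).
    by rewrite lee_fin ger0_norm ?mulr_ge0// ler_piMl.
by rewrite -(cvg_lim _ L1)// (funext E) (cvg_lim _ L2).
Unshelve. all: by end_near. Qed.

End random_time.

(** * Lattice measures *)

Lemma nneseries_eventually0 (R : realType) (f : nat -> \bar R) (N : nat) :
  (forall n, (0 <= f n)%E) -> (forall n, (N <= n)%N -> f n = 0%E) ->
  (\sum_(n <oo) f n = \sum_(n < N) f n)%E.
Proof.
move=> f0 fN; rewrite (nneseries_split 0 N)// add0n eseries0 ?adde0 ?big_mkord//.
by move=> n Nn _; exact: fN.
Qed.

Lemma EFin_nneseries (R : realType) (f : nat -> R) : cvgn (series f) ->
  (\sum_(n <oo) (f n)%:E = (limn (series f))%:E)%E.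
Proof.
move=> cf; rewrite -EFin_lim//; congr (limn _).
by apply/funext => n /=; rewrite /series /= sumEFin.
Qed.

Lemma series_pseries1 (R : realType) (f : nat -> R) : series f = pseries f 1.
Proof. by apply/funext => n; rewrite /pseries /series /=; apply: eq_bigr => i _; rewrite expr1n mulr1. Qed.

(** The point e^(iu) of the unit circle. *)
Definition circ {R : realType} (u : R) : R[i]%C := (cos u +i* sin u)%C.

Lemma circX (R : realType) (u : R) n : circ u ^+ n = circ (u * n%:R).
Proof.
elim: n => [|n IH]; first by rewrite expr0 /circ mulr0 cos0 sin0.
rewrite exprS IH -natr1 mulrDr mulr1 addrC /circ cosD sinD.
by apply/eqP; rewrite eq_complex /=; apply/andP; split; apply/eqP; ring.
Qed.

Section lattice.
Context {R : realType}.
Variables (k : nat) (q : 'I_k -> R).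
Hypothesis q_ge0 : forall j, 0 <= q j.
Let rho := \sum_(j < k) q j.

Lemma coef_jump_polyX_ge0 s n : 0 <= (jump_poly q ^+ s)`_n.
Proof.
have J0 m : 0 <= (jump_poly q)`_m.
  by rewrite coef_sum; apply: sumr_ge0 => j _; rewrite coefZ coefXn mulr_ge0.
elim: s n => [|s IH] n; first by rewrite expr0 coef1.
by rewrite exprS coefM; apply: sumr_ge0 => i _; rewrite mulr_ge0.
Qed.

(** With q_j = lambda_j / D this is w(u) = L(e^(iu)) / D. *)
Definition jump_cf (u : R) : R[i]%C := \sum_(j < k) (q j)%:C%C * circ u ^+ j.+1.

Lemma jump_cf0 : jump_cf 0 = (rho%:C)%C.
Proof.
rewrite /jump_cf /rho rmorph_sum; apply: eq_bigr => j _.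
by rewrite circX mul0r /circ cos0 sin0 mulr1.
Qed.

Lemma jump_cfX u s : jump_cf u ^+ s =
  \sum_(m < size (jump_poly q ^+ s)) ((jump_poly q ^+ s)`_m)%:C%C * circ (u * m%:R).
Proof.
have -> : jump_cf u = (map_poly (real_complex R) (jump_poly q)).[circ u].
  rewrite /jump_poly rmorph_sum horner_sum; apply: eq_bigr => j _.
  by rewrite /= map_polyZ map_polyXn hornerZ hornerXn.
rewrite -horner_exp -rmorphXn /= horner_coef size_map_poly.
by apply: eq_bigr => m _; rewrite coef_map circX.
Qed.

Definition jump_re u s := complex.Re (jump_cf u ^+ s).
Definition jump_im u s := complex.Im (jump_cf u ^+ s).

Lemma jump_reE u s : jump_re u s =
  \sum_(m < size (jump_poly q ^+ s)) (jump_poly q ^+ s)`_m * cos (u * m%:R).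
Proof.
rewrite /jump_re jump_cfX raddf_sum; apply: eq_bigr => m _ /=; ring.
Qed.

Lemma jump_imE u s : jump_im u s =
  \sum_(m < size (jump_poly q ^+ s)) (jump_poly q ^+ s)`_m * sin (u * m%:R).
Proof.
rewrite /jump_im jump_cfX raddf_sum; apply: eq_bigr => m _ /=; ring.
Qed.

Lemma sum_coef_jump_polyX s : \sum_(m < size (jump_poly q ^+ s)) (jump_poly q ^+ s)`_m = rho ^+ s.
Proof.
have := jump_reE 0 s; rewrite /jump_re jump_cf0 -rmorphXn /= => ->.
by apply: eq_bigr => m _; rewrite mul0r cos0 mulr1.
Qed.

Lemma jump_re_le u s : `|jump_re u s| <= rho ^+ s.
Proof.
rewrite jump_reE -sum_coef_jump_polyX (le_trans (ler_norm_sum _ _ _))// ler_sum// => m _.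
by rewrite normrM ger0_norm ?coef_jump_polyX_ge0// ler_piMr ?coef_jump_polyX_ge0// ler_norml cos_geN1 cos_le1.
Qed.

Lemma jump_im_le u s : `|jump_im u s| <= rho ^+ s.
Proof.
rewrite jump_imE -sum_coef_jump_polyX (le_trans (ler_norm_sum _ _ _))// ler_sum// => m _.
by rewrite normrM ger0_norm ?coef_jump_polyX_ge0// ler_piMr ?coef_jump_polyX_ge0// ler_norml sin_geN1 sin_le1.
Qed.

Lemma jump_reS u s : jump_re u s.+1 = jump_re u 1 * jump_re u s - jump_im u 1 * jump_im u s.
Proof. by rewrite /jump_re /jump_im exprS expr1; case: (jump_cf u) (jump_cf u ^+ s) => [? ?] [? ?]. Qed.

Lemma jump_imS u s : jump_im u s.+1 = jump_re u 1 * jump_im u s + jump_im u 1 * jump_re u s.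
Proof. by rewrite /jump_re /jump_im exprS expr1; case: (jump_cf u) (jump_cf u ^+ s) => [? ?] [? ?]. Qed.

(** Mass at n when s jumps, each of size j + 1 with weight q_j, carry the weight
    beta_s.  Only s <= n contributes. *)
Definition lattice_mass (beta : nat -> R) (n : nat) : R :=
  \sum_(s < n.+1) (jump_poly q ^+ s)`_n * beta s.

Variable beta : nat -> R.
Hypothesis beta_ge0 : forall s, 0 <= beta s.

Lemma lattice_mass_ge0 n : 0 <= lattice_mass beta n.
Proof. by apply: sumr_ge0 => s _; rewrite mulr_ge0// coef_jump_polyX_ge0. Qed.

(** Tonelli: summing over the position n first leaves, for each number of jumps s,
    a finite sum. *)
Lemma lattice_sum (phi : nat -> R) : (forall n, 0 <= phi n) ->
  (\sum_(n <oo) (lattice_mass beta n * phi n)%:E =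
   \sum_(s <oo) (beta s * \sum_(m < size (jump_poly q ^+ s)) (jump_poly q ^+ s)`_m * phi m)%:E)%E.
Proof.
move=> phi0.
pose t s n : \bar R := ((jump_poly q ^+ s)`_n * beta s * phi n)%:E.
have t0 s n : (0 <= t s n)%E by rewrite lee_fin !mulr_ge0// coef_jump_polyX_ge0.
transitivity (\sum_(n <oo) \sum_(s <oo) t s n)%E.
  apply: eq_eseriesr => n _; rewrite (@nneseries_eventually0 _ _ n.+1)//.
    by rewrite sumEFin /lattice_mass mulr_suml.
  by move=> s ns; rewrite /t jump_polyX_low// !mul0r.
rewrite nneseries_interchange//; apply: eq_eseriesr => s _.
rewrite (@nneseries_eventually0 _ _ (size (jump_poly q ^+ s)))//.
  by rewrite sumEFin mulr_sumr; congr EFin; apply: eq_bigr => m _; ring.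
by move=> m sm; rewrite /t nth_default// !mul0r.
Qed.

Variable mu : {measure set R -> \bar R}.
Hypothesis muE : forall A, measurable A ->
  (mu A = \sum_(n <oo) (lattice_mass beta n)%:E * \d_(n%:R : R) A)%E.

Lemma lattice_integral (f : R -> R) : measurable_fun setT f -> (forall x, 0 <= f x) ->
  (\int[mu]_x (f x)%:E =
   \sum_(s <oo) (beta s * \sum_(m < size (jump_poly q ^+ s)) (jump_poly q ^+ s)`_m * f m%:R)%:E)%E.
Proof.
move=> mf f0.
pose c n : {nonneg R} := NngNum (lattice_mass_ge0 n).
pose nu := mseries (fun n => mscale (c n) (\d_(n%:R : R))) 0.
have mfE : measurable_fun setT (EFin \o f) by exact/measurable_EFinP.
rewrite (eq_measure_integral nu); last by move=> A mA _; rewrite muE.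
rewrite ge0_integral_measure_series//; last by move=> x _; rewrite lee_fin.
rewrite -(@lattice_sum (fun n => f n%:R))//.
apply: eq_eseriesr => n _.
rewrite ge0_integral_mscale//; last by move=> x _; rewrite lee_fin.
by rewrite integral_dirac// diracT mul1e.
Qed.

Hypothesis beta_bounded : pbounded beta 1.
Hypothesis rho_gt0 : 0 < rho.
Hypothesis rho_lt1 : rho < 1.

Lemma cvg_lattice_pseries e : (forall s, `|e s| <= rho ^+ s) ->
  cvgn (pseries (fun s => beta s * e s) 1).
Proof.
move=> he; apply: (@is_cvg_pseries_pbounded _ _ (1 / rho)).
  exact: pboundedM.
by rewrite normr1 ltr_pdivlMr// mul1r.
Qed.

Lemma lattice_total : (mu setT = (limn (pseries (fun s => beta s * rho ^+ s) 1))%:E)%E.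
Proof.
have := @lattice_integral (cst 1) (measurable_cst _) (fun=> ler01).
have -> : (\int[mu]_x (cst 1 x)%:E = mu setT)%E by rewrite -[RHS]mul1e -integral_cst.
move=> ->.
rewrite -series_pseries1 -EFin_nneseries.
  apply: eq_eseriesr => s _; congr (_ * _)%:E; rewrite -sum_coef_jump_polyX.
  by apply: eq_bigr => m _; rewrite mulr1.
rewrite series_pseries1; apply: cvg_lattice_pseries => s.
by rewrite ger0_norm// exprn_ge0// ltW.
Qed.

Lemma lattice_finite : (mu setT < +oo)%E.
Proof. by rewrite lattice_total ltry. Qed.

Lemma lattice_integrable (f : R -> R) : measurable_fun setT f -> (forall x, `|f x| <= 1) ->
  mu.-integrable setT (EFin \o f).
Proof.
move=> mf f1; apply: measurable_bounded_integrable => //; first exact: lattice_finite.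
by exists 1; split => // y y1 x _ /=; rewrite (le_trans (f1 x))// ltW.
Qed.

Lemma lattice_bounded_integral (f : R -> R) (e : nat -> R) :
  measurable_fun setT f -> (forall x, `|f x| <= 1) ->
  (forall s, e s = \sum_(m < size (jump_poly q ^+ s)) (jump_poly q ^+ s)`_m * f m%:R) ->
  (forall s, `|e s| <= rho ^+ s) ->
  \int[mu]_x f x = limn (pseries (fun s => beta s * e s) 1).
Proof.
move=> mf f1 eE el.
have i1 : mu.-integrable setT (EFin \o (cst 1 : R -> R)).
  by apply: lattice_integrable => // x; rewrite normr1.
have i2 : mu.-integrable setT (EFin \o f) by exact: lattice_integrable.
have cr : cvgn (pseries (fun s => beta s * rho ^+ s) 1).
  by apply: cvg_lattice_pseries => s; rewrite ger0_norm// exprn_ge0// ltW.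
have ce := cvg_lattice_pseries el.
(* Tonelli needs a nonnegative integrand, whence the detour through 1 + f. *)
have fS : \int[mu]_x (1 + f x) = limn (pseries (fun s => beta s * rho ^+ s) 1) +
    limn (pseries (fun s => beta s * e s) 1).
  have <- : limn (pseries (fun s => 1 * (beta s * rho ^+ s) + 1 * (beta s * e s)) 1) =
      limn (pseries (fun s => beta s * rho ^+ s) 1) + limn (pseries (fun s => beta s * e s) 1).
    by rewrite limn_pseriesD// !mul1r.
  rewrite /Rintegral lattice_integral; last 2 first.
  - exact: measurable_funD.
  - by move=> x; have := f1 x; rewrite ler_norml => /andP[]; lra.
  rewrite -series_pseries1 -[RHS]/(fine (_)%:E) -EFin_nneseries.
    congr fine; apply: eq_eseriesr => s _; congr EFin.
    rewrite !mul1r -mulrDr; congr (_ * _).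
    rewrite eE -sum_coef_jump_polyX -big_split; apply: eq_bigr => m _ /=; ring.
  rewrite series_pseries1.
  by apply: cvgP; exact: cvg_pseriesD.
have := @RintegralD _ _ _ mu setT (cst 1) f measurableT i1 i2.
rewrite fS Rintegral_cst//.
have -> : fine (mu setT) = limn (pseries (fun s => beta s * rho ^+ s) 1) by rewrite lattice_total.
by rewrite mul1r => /addrI.
Qed.

Lemma lattice_cos u : \int[mu]_x cos (u * x) = limn (pseries (fun s => beta s * jump_re u s) 1).
Proof.
apply: lattice_bounded_integral.
- apply: (@measurableT_comp _ _ _ _ _ _ (@cos R)) => //.
  apply: continuous_measurable_fun; exact: continuous_cos.
- by move=> x; rewrite ler_norml cos_geN1 cos_le1.
- exact: jump_reE.
- exact: jump_re_le.
Qed.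

Lemma lattice_sin u : \int[mu]_x sin (u * x) = limn (pseries (fun s => beta s * jump_im u s) 1).
Proof.
apply: lattice_bounded_integral.
- apply: (@measurableT_comp _ _ _ _ _ _ (@sin R)) => //.
  apply: continuous_measurable_fun; exact: continuous_sin.
- by move=> x; rewrite ler_norml sin_geN1 sin_le1.
- exact: jump_imE.
- exact: jump_im_le.
Qed.

End lattice.

(** * The gamma-subordinated counting process *)

Lemma jump_poly_scale (R : fieldType) (k : nat) (lambda : 'I_k -> R) (D : R) s n :
  (jump_poly (fun j => lambda j / D) ^+ s)`_n = (jump_poly lambda ^+ s)`_n / D ^+ s.
Proof.
have -> : jump_poly (fun j => lambda j / D) = D^-1 *: jump_poly lambda.
  by rewrite /jump_poly scaler_sumr; apply: eq_bigr => j _; rewrite scalerA mulrC.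
by rewrite exprZn coefZ exprVn mulrC.
Qed.

(** The binomial series at a real point, as the case of a zero imaginary part. *)
Lemma binomial_series_real (R : realType) (r q : R) :
  0 <= r -> 0 < q -> q < 1 ->
  limn (pseries (fun s => rising_coeff r s * q ^+ s) 1) =
  expR (r * limn (pseries (fun s => s%:R^-1 * q ^+ s) 1)).
Proof.
move=> r0 q0 q1.
have [] := @binomial_series R r q (fun s => q ^+ s) (fun=> 0) r0 q0 q1.
- by rewrite expr0.
- by [].
- by move=> s; rewrite exprS expr1 mulr0 subr0.
- by move=> s; rewrite mulr0 mul0r addr0.
- by move=> s; rewrite ger0_norm// exprn_ge0// ltW.
- by move=> s; rewrite normr0 exprn_ge0// ltW.
move=> -> _; rewrite (_ : limn (pseries (fun s => s%:R^-1 * 0) 1) = 0) ?mulr0 ?cos0 ?mulr1//.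
apply: cvg_lim => //; rewrite (_ : pseries _ _ = cst 0); first exact: cvg_cst.
by apply/funext => n; rewrite /pseries /series /=; apply: big1 => i _; rewrite mulr0 mul0r.
Qed.

Section gamma_moments.
Context {R : realType}.
Variables (a b : R).
Hypothesis a_gt0 : 0 < a.

Lemma gamma_density_ge0 t x : 0 <= gamma_density a b t x.
Proof.
rewrite /gamma_density; case: ifP => // x0.
rewrite !mulr_ge0 ?powR_ge0 ?expR_ge0// invr_ge0.
apply: Rintegral_ge0 => u _.
by rewrite mulr_ge0 ?powR_ge0 ?expR_ge0.
Qed.

Lemma measurable_gamma_density t : measurable_fun setT (gamma_density a b t).
Proof.
apply: measurable_fun_if => //; first exact: measurable_fun_ltr.
apply: measurable_funTS.
under eq_fun do rewrite -mulrA.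
by apply: measurable_funM => //; exact: (measurable_gamma_kernel (b * t) a).
Qed.

(** x^s e^(-Dx) times a gamma density is an unnormalised gamma density again. *)
Lemma gamma_density_moment (t D : R) (s : nat) :
  (\int[lebesgue_measure]_x (x ^+ s * expR (- (D * x)) * gamma_density a b t x)%:E =
   (a `^ (b * t) / Gamma (b * t))%:E *
   \int[lebesgue_measure]_(x in `]0%R, +oo[) (gamma_kernel (b * t + s%:R) (D + a) x)%:E)%E.
Proof.
have G0 : 0 <= a `^ (b * t) / Gamma (b * t).
  rewrite mulr_ge0 ?powR_ge0// invr_ge0.
  by apply: Rintegral_ge0 => u _; rewrite mulr_ge0 ?powR_ge0 ?expR_ge0.
rewrite -ge0_integralZl//=; last 2 first.
- by apply/measurable_EFinP; exact: measurable_gamma_kernel.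
- by move=> x _; rewrite lee_fin gamma_kernel_ge0.
rewrite [RHS]integral_mkcond; apply: eq_integral => x _.
rewrite patchE /gamma_density; case: ifPn => [x0|/negbTE x0].
  rewrite mem_set; last by rewrite /= in_itv/= x0.
  have xE : x `^ (b * t + s%:R - 1) = x `^ (b * t - 1) * x ^+ s.
    rewrite addrAC powRD ?powR_mulrn ?(ltW x0)//.
    by apply/implyP => _; rewrite gt_eqF.
  rewrite /gamma_kernel xE mulrDl opprD expRD -EFinM; congr EFin; ring.
rewrite mulr0 ifF//; apply/negP; rewrite inE /= in_itv/= x0.
by [].
Qed.

Hypothesis b_gt0 : 0 < b.
Variable t : R.
Hypothesis t_gt0 : 0 < t.
Hypothesis density1 : (\int[lebesgue_measure]_x (gamma_density a b t x)%:E = 1)%E.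

(** The Laplace transform of the gamma law at D.  Its value (a / (a + D))^(bt) is not
    computed: it is recovered later as the normalisation of a probability. *)
Definition gamma_laplace (D : R) : R :=
  fine (\int[lebesgue_measure]_x (expR (- (D * x)) * gamma_density a b t x)%:E)%E.

(** The functional equation of the gamma function multiplies the moment of order s by
    (bt + s) / (D + a), which is the recurrence of the right-hand side. *)
Lemma gamma_moment (D : R) (s : nat) : 0 < D ->
  (\int[lebesgue_measure]_x (x ^+ s * expR (- (D * x)) * gamma_density a b t x)%:E =
   (gamma_laplace D * (s`!%:R * rising_coeff (b * t) s / (D + a) ^+ s))%:E)%E.
Proof.
move=> D0; have bt0 : 0 < b * t by rewrite mulr_gt0.
have Da : 0 < D + a by rewrite addr_gt0.
elim: s => [|s IH].
  rewrite fact0 /rising_coeff big_ord0 expr0 divr1 !mulr1 /gamma_laplace.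
  under eq_integral do rewrite expr0 mul1r.
  rewrite fineK// ge0_fin_numE; last first.
    by apply: integral_ge0 => x _; rewrite lee_fin mulr_ge0 ?expR_ge0 ?gamma_density_ge0.
  apply: (@le_lt_trans _ _ 1%E); last by rewrite ltry.
  rewrite -density1; apply: ge0_le_integral => //.
  - by move=> x _; rewrite lee_fin mulr_ge0 ?expR_ge0 ?gamma_density_ge0.
  - apply/measurable_EFinP; apply: measurable_funM; last exact: measurable_gamma_density.
    by apply: measurableT_comp => //; apply: measurableT_comp.
  - by apply/measurable_EFinP; exact: measurable_gamma_density.
  - move=> x _; rewrite lee_fin /gamma_density; case: ifP; rewrite ?mulr0// => x0.
    rewrite ler_piMl//; first by have := gamma_density_ge0 t x; rewrite /gamma_density x0.
    by rewrite -expR0 ler_expR lerNl oppr0 mulr_ge0// ltW.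
have h := @gamma_integralS R (b * t + s%:R) (D + a) (ltr_wpDr (ler0n _ s) bt0) Da.
move: IH; rewrite !gamma_density_moment -natr1 addrA => IH.
set K := (X in (X%:E * _)%E); set J := integral _ _ _ in h *.
transitivity (((D + a)^-1)%:E * (K%:E * ((D + a)%:E * J)))%E.
  by rewrite [in RHS]muleCA; congr (_ * _)%E; rewrite muleA -EFinM mulVf ?gt_eqF// mul1e.
rewrite h [X in (_ * X)%E]muleCA IH -!EFinM; congr EFin.
transitivity (gamma_laplace D * (s`!%:R * ((b * t + s%:R) * rising_coeff (b * t) s) / (D + a) ^+ s / (D + a))).
  ring.
by rewrite -rising_coeffS factS natrM exprSr invfM; ring.
Qed.

End gamma_moments.

(** At s = 0 the value is 0, so the measure built from these coefficients has no atom
    at 0. *)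
Definition levy_coeff {R : realType} (b : R) (s : nat) : R := b * s%:R^-1.

Lemma pboundedZ (R : realType) (c : nat -> R) (x r : R) : pbounded c r ->
  pbounded (fun s => x * c s) r.
Proof.
move=> cr y y0 yr; have [C hC] := cr y y0 yr; exists (`|x| * C) => s.
by rewrite normrM -mulrA ler_wpM2l.
Qed.

(** The Gamma(s) = (s - 1)! of the statement and the s! of the multinomial theorem
    leave b / s. *)
Lemma sum_Omega_levy (R : realType) (k : nat) (lambda : 'I_k -> R) (b D : R) (n : nat) :
  (0 < n)%N ->
  \sum_(x in Omega k n)
    (let s := (\sum_(j < k) x j)%N in
     (\prod_(j < k) (lambda j ^+ x j / (x j)`!%:R)) * (b * Gamma (s%:R : R) / D ^+ s)) =
  lattice_mass (fun j => lambda j / D) (levy_coeff b) n.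
Proof.
move=> n0; rewrite /= (sum_Omega lambda n (fun s => b * Gamma (s%:R : R) / D ^+ s)).
apply: eq_bigr => -[[|s] sn] _ /=.
  by rewrite /levy_coeff invr0 mulr0 expr0 coef1 eqn0Ngt n0 !mul0r.
rewrite jump_poly_scale GammaS /levy_coeff factS natrM invfM.
have s0 : s`!%:R != 0 :> R by rewrite pnatr_eq0 -lt0n fact_gt0.
transitivity ((jump_poly lambda ^+ s.+1)`_n / D ^+ s.+1 * (b / s.+1%:R) *
  (s`!%:R / s`!%:R)); first ring.
by rewrite divff// mulr1.
Qed.

(** A countable partition of the probability space according to the value of X. *)
Lemma lattice_law (R : realType) (d : measure_display) (T : measurableType d)
    (P : probability T R) (X : T -> nat) (p : nat -> R) :
  (forall A : set nat, measurable [set w | A (X w)]) ->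
  (forall n, P [set w | X w = n] = (p n)%:E) ->
  forall A : set R, P [set w | A (X w)%:R] = (\sum_(n <oo) (p n)%:E * \d_(n%:R : R) A)%E.
Proof.
move=> mX PX A.
have -> : [set w | A (X w)%:R] = \bigcup_n [set w | X w = n /\ A n%:R].
  apply/seteqP; split => w /=; first by move=> Aw; exists (X w).
  by move=> [n _ [-> ]].
rewrite measure_semi_bigcup.
- apply: eq_eseriesr => n _; rewrite diracE.
  have [/set_mem An|/negP An] := boolP (n%:R \in A).
    rewrite mule1 -PX; congr (P _); apply/seteqP; split => w /=; first by case.
    by move=> ->.
  rewrite mule0 (_ : mkset _ = set0) ?measure0//.
  by apply/seteqP; split => w //= -[_ An']; apply: An; apply/mem_set.
- by move=> n; exact: (mX [set m | m = n /\ A n%:R]).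
- by move=> i j _ _ [w [/= [<- _] [<- _]]].
- have := mX [set m | A m%:R]; congr measurable; apply/seteqP; split => w /=.
    by move=> Aw; exists (X w).
  by move=> [n _ [-> ]].
Qed.

Lemma Re_levy_integrand (R : realType) (y z : R) :
  complex.Re (cexp (0 +i* y)%C - 1 - (0 +i* z)%C) = cos y - 1.
Proof.
by rewrite /cexp /= expR0; ring.
Qed.

Lemma Im_levy_integrand (R : realType) (y z : R) :
  complex.Im (cexp (0 +i* y)%C - 1 - (0 +i* z)%C) = sin y - z.
Proof. by rewrite /cexp /= expR0; ring. Qed.

(** For e_s the real or imaginary part of w^s, that part of - log(1 - w). *)
Definition log_series {R : realType} (e : nat -> R) : R :=
  limn (pseries (fun s => s%:R^-1 * e s) 1).

(** Throughout, q_j = lambda_j / D with D = Lambda + a, and rho = Lambda / D. *)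
Section subordinated.
Context {R : realType} {d : measure_display} {T : measurableType d}.
Variable P : probability T R.
Variables (k : nat) (lambda : 'I_k -> R) (a b : R) (Z : R -> T -> R) (M : R -> T -> nat).
Hypothesis lambda_gt0 : forall j, 0 < lambda j.
Hypothesis k_ge1 : (1 <= k)%N.
Hypothesis a_gt0 : 0 < a.
Hypothesis b_gt0 : 0 < b.
Hypothesis Z_gamma : gamma_subordinator P a b Z.
Hypothesis M_gcp : generalized_counting_process P lambda M.
Hypothesis MZ_indep : independent_processes P M Z.

Let Lambda := \sum_(j < k) lambda j.
Let D := Lambda + a.
Let q j := lambda j / D.
Let rho := \sum_(j < k) q j.

Let Lambda_gt0 : 0 < Lambda.
Proof.
rewrite /Lambda (bigD1 (Ordinal k_ge1))//= ltr_wpDr// sumr_ge0// => j _.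
exact: ltW.
Qed.

Let D_gt0 : 0 < D. Proof. by rewrite addr_gt0. Qed.

Let q_ge0 j : 0 <= q j. Proof. by rewrite divr_ge0// ltW. Qed.

Let rhoE : rho = Lambda / D. Proof. by rewrite /rho mulr_suml. Qed.

Let rho_gt0 : 0 < rho. Proof. by rewrite rhoE divr_gt0. Qed.

Let rho_lt1 : rho < 1. Proof. by rewrite rhoE ltr_pdivrMr// mul1r ltrDl. Qed.

Let Z_ge0 t w : 0 <= t -> 0 <= Z t w.
Proof.
move=> t0; have [[[_ Z0 _ _ _] Zmono] _] := Z_gamma.
by rewrite -(Z0 w); exact: Zmono.
Qed.

Let mZ t : 0 <= t -> measurable_fun setT (Z t).
Proof. by move=> t0; have [[[mZ _ _ _ _] _] _] := Z_gamma; exact: mZ. Qed.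

Let mM t : 0 <= t -> measurable_fun setT (M t).
Proof. by move=> t0; have [[mM _ _ _] _] := M_gcp; exact: mM. Qed.

Let M_right w t : 0 <= t -> ((M s w)%:R : R) @[s --> t^'+] --> ((M t w)%:R : R).
Proof. by move=> t0; have [[_ _ _ /(_ w)[+ _]] _] := M_gcp; exact. Qed.

Let density1 t : 0 < t -> (\int[lebesgue_measure]_x (gamma_density a b t x)%:E = 1)%E.
Proof.
move=> t0; have [_ /(_ t setT t0 measurableT) <-] := Z_gamma.
by rewrite -(@probability_setT _ _ _ P); congr (P _); apply/seteqP.
Qed.

Lemma measurable_subordinated t : 0 <= t -> measurable_fun setT (fun w => (M (Z t w) w)%:R : R).
Proof.
move=> t0; apply: measurable_random_time => //; first exact: mZ.
by move=> w; exact: Z_ge0.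
Qed.

Lemma measurable_gcp_pmf n : measurable_fun setT (gcp_pmf lambda n).
Proof.
apply: measurable_sum => s; apply: measurable_funM => //; apply: measurable_funM => //.
by apply: measurableT_comp => //; apply: measurableT_comp.
Qed.

Lemma continuous_gcp_pmf n (t : R) : gcp_pmf lambda n x @[x --> t] --> gcp_pmf lambda n t.
Proof.
apply: cvg_big => // [|s _]; first by move=> z; exact: add_continuous.
 apply: cvgMr; apply: cvgM; first exact: exprn_continuous.
apply: continuous_comp; last exact: continuous_expR.
by apply: cvgN; apply: cvgMr; exact: cvg_id.
Qed.

(** The sequence beta of the law of M(Z(t)). *)
Definition subordinated_coeff (t : R) (s : nat) : R :=
  gamma_laplace a b t Lambda * rising_coeff (b * t) s.

(** Each term of the mass function of M(x) integrates against the gamma density to a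
    moment of order s; the factor D^(-s) of the moment rescales lambda to q. *)
Lemma subordinated_pmf t n : 0 < t ->
  P [set w | M (Z t w) w = n] = (lattice_mass q (subordinated_coeff t) n)%:E.
Proof.
move=> t0.
rewrite (@random_time_pmf _ _ _ M (Z t) mM M_right (mZ (ltW t0)) _ P
   (gamma_density a b t) (gcp_pmf lambda n) n); first last.
- move=> x A x0 mA; apply: MZ_indep.
    exact: (@process_sigma_algebra_preimage _ _ _ _ _ M x [set n] x0).
  exact: process_sigma_algebra_preimage (ltW t0) mA.
- by move=> x x0; apply: gcp_law.
- by move=> x _; exact: continuous_gcp_pmf.
- exact: measurable_gcp_pmf.
- exact: measurable_gamma_density.
- by move=> x x0; rewrite /gamma_density ltNge x0.
- by move=> x; exact: gamma_density_ge0.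
- by move=> A mA; have [_ /(_ t A t0 mA)] := Z_gamma.
- by move=> w; exact: Z_ge0 (ltW t0).
pose c s := (jump_poly lambda ^+ s)`_n / s`!%:R.
have c0 s : 0 <= c s.
  by rewrite divr_ge0// coef_jump_polyX_ge0// => j; exact: ltW.
transitivity (\int[lebesgue_measure]_x \sum_(s < n.+1) (c s)%:E *
    (x ^+ s * expR (- (Lambda * x)) * gamma_density a b t x)%:E)%E.
  apply: eq_integral => x _; rewrite /gcp_pmf mulr_suml -sumEFin.
  by apply: eq_bigr => s _; rewrite -EFinM /c; congr EFin; ring.
have f0 s x : 0 <= x ^+ s * expR (- (Lambda * x)) * gamma_density a b t x.
  have [x0|x0] := leP x 0; first by rewrite /gamma_density ltNge x0 mulr0.
  by rewrite !mulr_ge0 ?expR_ge0 ?gamma_density_ge0// exprn_ge0// ltW.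
have mf s : measurable_fun setT (fun x : R => (x ^+ s * expR (- (Lambda * x)) * gamma_density a b t x)%:E).
  apply/measurable_EFinP; apply: measurable_funM; last exact: measurable_gamma_density.
  apply: measurable_funM; first exact: measurable_funX.
  by apply: measurableT_comp => //; apply: measurableT_comp.
rewrite ge0_integral_sum//; last 2 first.
- by move=> s; apply: measurable_funeM; exact: mf.
- by move=> s x _; rewrite mule_ge0// lee_fin.
rewrite /lattice_mass -sumEFin; apply: eq_bigr => s _.
rewrite ge0_integralZl//; last 3 first.
- exact: mf.
- by move=> x _; rewrite lee_fin.
- by rewrite lee_fin.
rewrite gamma_moment//; last exact: density1.
rewrite -EFinM; congr EFin; rewrite /c jump_poly_scale /subordinated_coeff -/D.
have s0 : s`!%:R != 0 :> R by rewrite pnatr_eq0 -lt0n fact_gt0.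
field; rewrite s0 gt_eqF// exprn_gt0//.
Qed.

Let levy_coeff_ge0 s : 0 <= levy_coeff b s.
Proof. by rewrite /levy_coeff mulr_ge0 ?invr_ge0// ltW. Qed.

Let pbounded_levy_coeff : pbounded (levy_coeff b) 1.
Proof. by apply: pboundedZ; exact: pbounded_inv. Qed.

Let subordinated_coeff_ge0 t s : 0 < t -> 0 <= subordinated_coeff t s.
Proof.
move=> t0; rewrite mulr_ge0 ?rising_coeff_ge0//; last by rewrite mulr_ge0 ?ltW.
apply: fine_ge0; apply: integral_ge0 => x _.
by rewrite lee_fin mulr_ge0 ?expR_ge0 ?gamma_density_ge0.
Qed.

Let pbounded_subordinated_coeff t : 0 < t -> pbounded (subordinated_coeff t) 1.
Proof.
by move=> t0; apply: pboundedZ; apply: pbounded_rising_coeff; rewrite mulr_ge0 ?ltW.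
Qed.

Let cvg_rho (c e : nat -> R) : pbounded c 1 -> (forall s, `|e s| <= rho ^+ s) ->
  cvgn (pseries (fun s => c s * e s) 1).
Proof. by move=> cb eb; exact: (@cvg_lattice_pseries _ _ q). Qed.

Let levy_series e : (forall s, `|e s| <= rho ^+ s) ->
  limn (pseries (fun s => levy_coeff b s * e s) 1) = b * log_series e.
Proof.
move=> eb; rewrite /log_series -limn_pseriesZ; last exact: (cvg_rho (@pbounded_inv R) eb).
by congr (limn (pseries _ _)); apply/funext => s; rewrite mulrA.
Qed.

Let subordinated_series t e : 0 < t -> (forall s, `|e s| <= rho ^+ s) ->
  limn (pseries (fun s => subordinated_coeff t s * e s) 1) =
  gamma_laplace a b t Lambda * limn (pseries (fun s => rising_coeff (b * t) s * e s) 1).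
Proof.
move=> t0 eb; rewrite -limn_pseriesZ.
  by congr (limn (pseries _ _)); apply/funext => s; rewrite mulrA.
by apply: cvg_rho => //; apply: pbounded_rising_coeff; rewrite mulr_ge0 ?ltW.
Qed.

Let rhoX_le s : `|rho ^+ s| <= rho ^+ s.
Proof. by rewrite ger0_norm// exprn_ge0// ltW. Qed.

Section law.
Variable t : R.
Hypothesis t_gt0 : 0 < t.
Let X : T -> R := fun w => (M (Z t w) w)%:R.
Let mX : measurable_fun setT X. Proof. exact: measurable_subordinated (ltW t_gt0). Qed.
HB.instance Definition _ := isMeasurableFun.Build _ _ _ _ X mX.
Let law : {measure set R -> \bar R} := distribution P X.

Let lawE A : measurable A ->
  (law A = \sum_(n <oo) (lattice_mass q (subordinated_coeff t) n)%:E * \d_(n%:R : R) A)%E.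
Proof.
move=> mA; rewrite -(@lattice_law _ _ _ P (fun w => M (Z t w) w))// => [B|n].
  apply: (@measurable_random_time_nat _ _ _ M (Z t) mM M_right (mZ (ltW t_gt0))).
  by move=> w; exact: Z_ge0 (ltW t_gt0).
exact: subordinated_pmf.
Qed.

(** The total mass of the law of M(Z(t)) is 1. *)
Let laplaceE : gamma_laplace a b t Lambda = expR (- (b * t * log_series (fun s => rho ^+ s))).
Proof.
have := lattice_total q_ge0 (fun s => subordinated_coeff_ge0 s t_gt0) lawE
  (pbounded_subordinated_coeff t_gt0) rho_gt0 rho_lt1.
have -> : law setT = 1%E by exact: (@probability_setT _ _ _ (distribution P X)).
rewrite subordinated_series// binomial_series_real//; last by rewrite mulr_ge0 ?ltW.
move=> [] /esym h.
by rewrite expRN -[RHS]mul1r -h mulfK// gt_eqF// expR_gt0.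
Qed.

Let law_Rintegral (f : R -> R) : measurable_fun setT f -> (forall x, `|f x| <= 1) ->
  \int[P]_w f (X w) = \int[law]_x f x.
Proof.
move=> mf f1; congr fine.
rewrite /law /distribution (integral_pushforward mX)//.
  exact/measurable_EFinP.
rewrite preimage_setT; apply: measurable_bounded_integrable => //.
- by rewrite (le_lt_trans (probability_le1 P measurableT))// ltry.
- exact: measurableT_comp.
- by exists 1; split => // y y1 x _ /=; rewrite (le_trans (f1 _))// ltW.
Qed.

Lemma subordinated_cf_gt0 u :
  characteristic_function P (fun w => (M (Z t w) w)%:R) u =
  cexp ((t%:C)%C * (b * (log_series (jump_re q u) - log_series (fun s => rho ^+ s)) +i*
     (b * log_series (jump_im q u)))%C).
Proof.
have bt0 : 0 <= b * t by rewrite mulr_ge0 ?ltW.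
have [reE imE] := @binomial_series R (b * t) rho (jump_re q u) (jump_im q u) bt0 rho_gt0 rho_lt1
  erefl erefl (jump_reS q u) (jump_imS q u) (jump_re_le q_ge0 u) (jump_im_le q_ge0 u).
have s0 s := subordinated_coeff_ge0 s t_gt0.
have sb := pbounded_subordinated_coeff t_gt0.
rewrite /characteristic_function /cintegral /cexp /= !mul0r !subr0 !addr0.
under eq_Rintegral do rewrite expR0 mul1r.
under [in X in (_ +i* X)%C]eq_Rintegral do rewrite expR0 mul1r.
rewrite (law_Rintegral (f := fun x => cos (u * x))); last 2 first.
- by apply: (@measurableT_comp _ _ _ _ _ _ (@cos R)) => //;
    apply: continuous_measurable_fun; exact: continuous_cos.
- by move=> x; rewrite ler_norml cos_geN1 cos_le1.
rewrite (law_Rintegral (f := fun x => sin (u * x))); last 2 first.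
- by apply: (@measurableT_comp _ _ _ _ _ _ (@sin R)) => //;
    apply: continuous_measurable_fun; exact: continuous_sin.
- by move=> x; rewrite ler_norml sin_geN1 sin_le1.
rewrite (lattice_cos q_ge0 s0 lawE)// (lattice_sin q_ge0 s0 lawE)//.
rewrite !subordinated_series//; [|exact: jump_im_le|exact: jump_re_le].
rewrite reE imE laplaceE !mulrA -!expRD.
by congr (expR _ * cos _ +i* (expR _ * sin _))%C; rewrite /log_series; ring.
Qed.

End law.

Lemma subordinated_cf t u : 0 <= t ->
  characteristic_function P (fun w => (M (Z t w) w)%:R) u =
  cexp ((t%:C)%C * (b * (log_series (jump_re q u) - log_series (fun s => rho ^+ s)) +i*
     (b * log_series (jump_im q u)))%C).
Proof.
rewrite le_eqVlt => /predU1P[<-|]; last by move=> t0; exact: subordinated_cf_gt0.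
have [[_ M0 _ _] _] := M_gcp; have [[[_ Z0 _ _ _] _] _] := Z_gamma.
rewrite /characteristic_function /cintegral /cexp /=.
under eq_Rintegral do rewrite Z0 M0 !(mulr0, mul0r, subr0, addr0) cos0 expR0 mulr1.
under [in X in (_ +i* X)%C]eq_Rintegral do rewrite Z0 M0 !(mulr0, mul0r, subr0, addr0) sin0 mulr0.
rewrite !(mulr0, mul0r, subr0, addr0) cos0 sin0 expR0 mulr1 mulr0.
rewrite !Rintegral_cst// mul0r mul1r.
exact: (congr1 (fun z => (fine z +i* 0)%C) (@probability_setT _ _ _ P)).
Qed.

Section levy_measure.
Variable nu : {measure set R -> \bar R}.
Hypothesis nuE : forall A, measurable A ->
  (nu A = \sum_(n <oo) (lattice_mass q (levy_coeff b) n)%:E * \d_(n%:R : R) A)%E.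

(** The truncation function of the Levy-Khintchine exponent, up to the factor u. *)
Let small_jumps (x : R) : R := if `|x| <= 1 then x else 0.

Let measurable_small_jumps : measurable_fun setT small_jumps.
Proof.
apply: measurable_fun_if => //; apply: measurable_fun_ler => //.
Qed.

Let small_jumps_le1 x : `|small_jumps x| <= 1.
Proof. by rewrite /small_jumps; case: ifP => // _; rewrite normr0. Qed.

Let nu_total : (nu setT = (b * log_series (fun s => rho ^+ s))%:E)%E.
Proof.
by rewrite (lattice_total q_ge0 levy_coeff_ge0 nuE pbounded_levy_coeff rho_gt0 rho_lt1) levy_series.
Qed.

Let nu_integrable (f : R -> R) : measurable_fun setT f -> (forall x, `|f x| <= 1) ->
  nu.-integrable setT (EFin \o f).
Proof. exact: (lattice_integrable q_ge0 levy_coeff_ge0 nuE). Qed.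

Let measurable_cosM u : measurable_fun setT (fun x : R => cos (u * x)).
Proof.
by apply: (@measurableT_comp _ _ _ _ _ _ (@cos R)) => //;
  apply: continuous_measurable_fun; exact: continuous_cos.
Qed.

Let measurable_sinM u : measurable_fun setT (fun x : R => sin (u * x)).
Proof.
by apply: (@measurableT_comp _ _ _ _ _ _ (@sin R)) => //;
  apply: continuous_measurable_fun; exact: continuous_sin.
Qed.

(** The drift cancels the compensation of the small jumps, which leaves the integral
    of e^(iux) - 1. *)
Lemma levy_exponentE u :
  levy_khintchine_exponent (\int[nu]_x small_jumps x) 0 nu u =
  (b * (log_series (jump_re q u) - log_series (fun s => rho ^+ s)) +i*
     (b * log_series (jump_im q u)))%C.
Proof.
have ic : nu.-integrable setT (EFin \o (fun x => cos (u * x))).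
  by apply: nu_integrable => // x; rewrite ler_norml cos_geN1 cos_le1.
have is_ : nu.-integrable setT (EFin \o (fun x => sin (u * x))).
  by apply: nu_integrable => // x; rewrite ler_norml sin_geN1 sin_le1.
have i1 : nu.-integrable setT (EFin \o (cst 1 : R -> R)).
  by apply: nu_integrable => // x; rewrite normr1.
have ij : nu.-integrable setT (EFin \o small_jumps) by exact: nu_integrable.
rewrite /levy_khintchine_exponent /cintegral.
rewrite [X in _ + (X +i* _)%C](@eq_Rintegral _ _ _ nu setT (fun x => cos (u * x) - cst 1 x)); last first.
  by move=> x _; exact: Re_levy_integrand.
rewrite RintegralB//.
rewrite [X in _ + (_ +i* X)%C](@eq_Rintegral _ _ _ nu setT (fun x => sin (u * x) - u * small_jumps x)); last first.
  by move=> x _; rewrite Im_levy_integrand /small_jumps; case: ifP => _; rewrite ?mulr0.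
rewrite RintegralB//; last exact: (integrableZl measurableT u ij).
rewrite RintegralZl// Rintegral_cst//.
rewrite (lattice_cos q_ge0 levy_coeff_ge0 nuE)// (lattice_sin q_ge0 levy_coeff_ge0 nuE)//.
rewrite !levy_series//; [|exact: jump_im_le|exact: jump_re_le].
rewrite nu_total /=.
by apply/eqP; rewrite eq_complex /=; apply/andP; split; apply/eqP; ring.
Qed.

Lemma levy_measure_subordinated : is_levy_measure P (fun t w => (M (Z t w) w)%:R) nu.
Proof.
split.
- exact: measurable_subordinated.
- rewrite nuE// eseries0// => -[|n] _ _.
    by rewrite /lattice_mass big_ord1 /levy_coeff invr0 !mulr0 mul0e.
  by rewrite diracE memNset ?mule0//= => /eqP; rewrite pnatr_eq0.
- apply: (@le_lt_trans _ _ (nu setT)); last by rewrite nu_total ltry.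
  rewrite -[leRHS]mul1e -integral_cst//; apply: ge0_le_integral => //.
  - by move=> x _; rewrite lee_fin le_min ler01 sqr_ge0.
  - apply/measurable_EFinP; apply: measurable_minr => //; exact: measurable_funX.
  - by move=> x _; rewrite lee_fin ge_min lexx.
- exists (\int[nu]_x small_jumps x), 0; split => // t u t0.
  by rewrite subordinated_cf// levy_exponentE.
Qed.

End levy_measure.

End subordinated.

Theorem proposition4p2 (R : realType) (d : measure_display)
    (T : measurableType d) (P : probability T R)
    (k : nat) (k_ge1 : (1 <= k)%N)
    (lambda : 'I_k -> R) (lambda_gt0 : forall j, 0 < lambda j)
    (a b : R) (a_gt0 : 0 < a) (b_gt0 : 0 < b)
    (Z : R -> T -> R) (Z_gamma : gamma_subordinator P a b Z)
    (M : R -> T -> nat) (M_gcp : generalized_counting_process P lambda M)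
    (MZ_indep : independent_processes P M Z) :
  let Lambda := \sum_(j < k) lambda j in
  exists Pi : {measure set R -> \bar R},
    (forall A : set R, measurable A ->
       Pi A =
       (\sum_(1 <= n <oo)
          (\sum_(x in Omega k n)
             let s := (\sum_(j < k) x j)%N in
             (\prod_(j < k) (lambda j ^+ x j / (x j)`!%:R)) *
             (b * Gamma (s%:R : R) / (Lambda + a) ^+ s))%R%:E
          * \d_(n%:R : R) A)%E) /\
    is_levy_measure P (fun t w => (M (Z t w) w)%:R) Pi.
Proof.
move=> Lambda.
pose q j := lambda j / (Lambda + a).
have q0 j : 0 <= q j.
  by rewrite divr_ge0 ?addr_ge0 ?sumr_ge0 ?(ltW a_gt0) ?(ltW (lambda_gt0 j))// => i _; exact: ltW.
have c0 s : 0 <= levy_coeff b s by rewrite /levy_coeff mulr_ge0 ?invr_ge0// ltW.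
have m0 n : 0 <= lattice_mass q (levy_coeff b) n by exact: lattice_mass_ge0.
pose Pi : {measure set R -> \bar R} :=
  mseries (fun n => mscale (NngNum (m0 n)) (\d_(n%:R : R))) 0.
exists Pi; split; last exact: (levy_measure_subordinated lambda_gt0 k_ge1 a_gt0 b_gt0).
move=> A mA.
rewrite /Pi /= /mseries (nneseries_split 0 1)//.
have m00 : lattice_mass q (levy_coeff b) 0 = 0.
  by rewrite /lattice_mass big_ord1 /levy_coeff invr0 !mulr0.
have h0 : mscale (NngNum (m0 0%N)) \d_(0%:R : R) A = 0%E.
  by transitivity ((lattice_mass q (levy_coeff b) 0)%:E * \d_(0%:R : R) A)%E; rewrite ?m00 ?mul0e.
rewrite [X in (X + _)%E](_ : _ = 0%E) ?add0e; last by rewrite big_nat1; exact: h0.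
apply/congr_lim/funext => N; apply: eq_big_nat => n /andP[n1 _].
transitivity ((lattice_mass q (levy_coeff b) n)%:E * \d_(n%:R : R) A)%E => //.
by congr (_%:E * _)%E; rewrite -sum_Omega_levy.
Qed.
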